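(* Let $d=2j+1$ be a positive odd integer ($j\ge 0$ an integer) and let $\sigma=\begin{pmatrix} a & b\\ b & c\end{pmatrix}$ be a real symmetric positive definite matrix. Then there is a constant $C_\sigma$ (not depending on $n_1,n_2,k_1,k_2$) such that, for all integers $n_1,n_2,k_1,k_2$, $$\mathbf{W}_{\mathbf{g}_\sigma}(n_1,n_2,k_1,k_2)=C_\sigma\sum_{\alpha_1,\alpha_2=-\infty}^{\infty}\ \sum_{\beta_1,\beta_2=-\infty}^{\infty}(-1)^{\alpha_1\beta_1+\alpha_2\beta_2}\,\mathcal{W}_{g_\sigma}\left(\left(n_1+\alpha_1\tfrac d2\right)\sqrt{\tfrac{2\pi}{d}},\ \left(n_2+\alpha_2\tfrac d2\right)\sqrt{\tfrac{2\pi}{d}},\ \left(k_1+\beta_1\tfrac d2\right)\sqrt{\tfrac{2\pi}{d}},\ \left(k_2+\beta_2\tfrac d2\right)\sqrt{\tfrac{2\pi}{d}}\right).$$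
   Context: Fix a positive odd integer $d=2j+1$. For a real symmetric positive definite $2\times 2$ matrix $\sigma$, the Gaussian function of two continuous variables is $g_\sigma:\mathbb{R}\times\mathbb{R}\to\mathbb{R}$, $$g_\sigma(q_1,q_2)=\exp\left(-\frac12\,(q_1,\,q_2)\,\sigma\begin{pmatrix} q_1 \\ q_2 \end{pmatrix}\right),$$ and the corresponding Gaussian function of two discrete variables is $\mathbf{g}_\sigma:\mathbb{Z}\times\mathbb{Z}\to\mathbb{R}$, $$\mathbf{g}_\sigma(n_1,n_2)=\sum_{\alpha_1,\alpha_2=-\infty}^{\infty}g_\sigma\left((n_1+\alpha_1d)\sqrt{\tfrac{2\pi}{d}},\ (n_2+\alpha_2d)\sqrt{\tfrac{2\pi}{d}}\right).$$ The continuous Wigner function of $\psi:\mathbb{R}\times\mathbb{R}\to\mathbb{C}$ is $$\mathcal{W}_\psi(q_1,q_2,p_1,p_2)=\frac1{\pi^2}\int_{-\infty}^{\infty}\int_{-\infty}^{\infty}e^{-2\mathrm{i}(p_1x_1+p_2x_2)}\,\overline{\psi(q_1-x_1,q_2-x_2)}\,\psi(q_1+x_1,q_2+x_2)\,dx_1dx_2.$$ The discrete Wigner function of $\psi:\mathbb{Z}\times\mathbb{Z}\to\mathbb{C}$ ($d$-periodic in each variable) is $$\mathbf{W}_\psi(n_1,n_2,k_1,k_2)=\frac1{d^2}\sum_{m_1=-j}^{j}\sum_{m_2=-j}^{j}e^{-\frac{4\pi \mathrm{i}}{d}(k_1m_1+k_2m_2)}\,\overline{\psi(n_1-m_1,n_2-m_2)}\,\psi(n_1+m_1,n_2+m_2).$$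 *)

(* Defs.v *)
From HB Require Import structures.
From mathcomp Require Import all_boot all_order all_algebra finmap complex.
From mathcomp Require Import all_classical all_reals all_analysis.
From mathcomp Require summability.

Set Implicit Arguments.
Unset Strict Implicit.
Unset Printing Implicit Defensive.

Import Order.TTheory GRing.Theory Num.Theory.
Import numFieldNormedType.Exports.

Local Open Scope classical_set_scope.
Local Open Scope ring_scope.
Local Open Scope complex_scope.

(* Sums over Z x Z are unordered: limits of the partial sums along the net of
   finite subsets of Z x Z.  [cvg_sumZ2 f] says that this limit exists; without
   it [sumZ2 f] is unspecified. *)
Definition cvg_sumZ2 (K : numFieldType) (f : int -> int -> K) : Prop :=
  cvg (summability.partial_sum (fun a : int * int => f a.1 a.2 : K^o)
       @ summability.totally).

Definition sumZ2 (K : numFieldType) (f : int -> int -> K) : K :=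
  summability.sum (fun a : int * int => f a.1 a.2 : K^o).

Section Wigner.
Variable R : realType.

(* e^(i t), by Euler's formula *)
Definition expi (t : R) : R[i] := cos t +i* sin t.

(* Lebesgue integral over the real line of a complex-valued function *)
Definition cintegral (f : R -> R[i]) : R[i] :=
  (\int[lebesgue_measure]_x complex.Re (f x)) +i*
  (\int[lebesgue_measure]_x complex.Im (f x)).

Definition posdef (n : nat) (A : 'M[R]_n) : Prop :=
  forall v : 'rV[R]_n, v != 0 -> 0 < (v *m A *m v^T) 0 0.

Definition gauss (sigma : 'M[R]_2) (q1 q2 : R) : R :=
  let q : 'rV[R]_2 := \row_i [:: q1; q2]`_i in
  expR (- (1 / 2) * (q *m sigma *m q^T) 0 0).

Definition wigner (psi : R -> R -> R[i]) (q1 q2 p1 p2 : R) : R[i] :=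
  (1 / pi ^+ 2)%:C *
  cintegral (fun x2 => cintegral (fun x1 =>
    expi (- 2 * (p1 * x1 + p2 * x2)) *
    (psi (q1 - x1) (q2 - x2))^* * psi (q1 + x1) (q2 + x2))).

(* In the discrete setting the period is d = 2 j + 1. *)
Definition period (j : nat) : nat := (2 * j + 1)%N.

Definition scale (j : nat) : R := Num.sqrt (2 * pi / (period j)%:R).

Definition dgauss (j : nat) (sigma : 'M[R]_2) (n1 n2 : int) : R :=
  sumZ2 (fun a1 a2 : int =>
    gauss sigma ((n1 + a1 * (period j)%:Z)%:~R * scale j)
                ((n2 + a2 * (period j)%:Z)%:~R * scale j)).

(* The index m : 'I_(period j) stands for the integer m - j in [-j, j]. *)
Definition dwigner (j : nat) (psi : int -> int -> R[i]) (n1 n2 k1 k2 : int)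
    : R[i] :=
  (1 / (period j)%:R ^+ 2)%:C *
  \sum_(i1 < period j) \sum_(i2 < period j)
    (let m1 : int := i1%:Z - j%:Z in
     let m2 : int := i2%:Z - j%:Z in
     expi (- (4 * pi / (period j)%:R) * (k1 * m1 + k2 * m2)%:~R) *
     (psi (n1 - m1) (n2 - m2))^* * psi (n1 + m1) (n2 + m2)).

(* the phase-space point (n + alpha d / 2) sqrt (2 pi / d) *)
Definition halfpt (j : nat) (n alpha : int) : R :=
  (n%:~R + alpha%:~R * ((period j)%:R / 2)) * scale j.

End Wigner.

(* Main.v *)
Require Import Defs.
From HB Require Import structures.
From mathcomp Require Import all_boot all_order all_algebra finmap complex.
From mathcomp Require Import all_classical all_reals all_analysis.
From mathcomp Require summability.
From mathcomp Require Import measurable_realfun ring lra zify.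
Set Implicit Arguments.
Unset Strict Implicit.
Unset Printing Implicit Defensive.
Import Order.TTheory GRing.Theory Num.Theory.
Import numFieldNormedType.Exports.
Local Open Scope ring_scope.
Local Open Scope complex_scope.

(* Writing n - m + alpha d and n + m + beta d as (n + gamma d/2) -+ (M + gamma d/2)
   with gamma = alpha + beta and M = m - alpha d, the parallelogram law turns
   d^2 W(n, k) into the sum over gamma of g(n + gamma d/2)^2 times
   sum_M exp(-4 pi i k.M/d) g(M + gamma d/2)^2.  Poisson summation in M gives a
   sum over the dual Gaussian at k + q d/2 with signs (-1)^(gamma.q), since d is
   odd; and the continuous Wigner function of a Gaussian is, up to a constant,
   the product of the Gaussian squared and its dual.

   The two-dimensional Poisson formula follows from the one-dimensional one by
   completing the square.  The latter, up to a multiplicative constant that need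
   not be known, is obtained by Polya's method: sampling the Fourier series
   of cos^(2m) at n equidistant points relates a sum of central binomial
   coefficients over an arithmetic progression of step n to a sum of values of
   cos^(2m); with m ~ n^2/A, both sides converge to Gaussian sums. *)

(** * Unordered sums *)

(** Since the theorem only asks for some [C], neither Stirling's formula nor the value of the
    Gaussian integral enters. Polya's identity carries a factor that depends on its step and
    exponent alone, not on the position [t] or the frequency [y]; comparing with the case
    [t = y = 0], where the dual sum is non-zero, eliminates it. That the constant is the same for
    all shifts is also what lets the one-dimensional formula be iterated: after completing the
    square, the shift in one variable depends on the other. The recurring obstacle is the order of
    summation. Fubini for [has_usum] goes from a joint sum to an iterated one, so each interchange
    starts by dominating a family over a product of index sets, in the end by products of
    one-dimensional Gaussians and hence by geometric series. The Fourier transform of the Gaussian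
    comes from a first-order differential equation in the frequency. *)

Section UnorderedSums.
Variable K : numFieldType.

(* Unordered sums, with duplicate-free lists playing the part of finite sets. *)
Definition has_usum (I : eqType) (f : I -> K) (l : K) : Prop :=
  forall e, 0 < e -> exists A : seq I, forall B : seq I,
    uniq B -> {subset A <= B} -> `|\sum_(i <- B) f i - l| < e.

Lemma has_usum_unique (I : eqType) (f : I -> K) l l' :
  has_usum f l -> has_usum f l' -> l = l'.
Proof.
move=> hl hl'; apply/eqP; rewrite -subr_eq0 -normr_le0.
apply/ler_addgt0Pl => e e0; rewrite addr0.
have e20 : 0 < e / 2 by rewrite divr_gt0.
have [A hA] := hl _ e20; have [A' hA'] := hl' _ e20.
have uB := undup_uniq (A ++ A').
have {}hA := hA _ uB _; have {}hA' := hA' _ uB _.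
rewrite -(subrKA (\sum_(i <- undup (A ++ A')) f i)).
rewrite (le_trans (ler_normD _ _))// [leRHS]splitr lerD// ltW//.
  by rewrite distrC; apply: hA => x xA; rewrite mem_undup mem_cat xA.
by apply: hA' => x xA; rewrite mem_undup mem_cat xA orbT.
Qed.

Lemma eq_has_usum (I : eqType) (f g : I -> K) l :
  f =1 g -> has_usum f l -> has_usum g l.
Proof.
move=> fg hf e e0; have [A hA] := hf e e0; exists A => B uB AB.
by rewrite -(eq_bigr _ (fun i _ => fg i)) hA.
Qed.

Lemma has_usum0 (I : eqType) : has_usum (fun _ : I => 0) 0.
Proof. by move=> e e0; exists [::] => B _ _; rewrite big1// subrr normr0. Qed.

Lemma has_usumD (I : eqType) (f g : I -> K) l l' :
  has_usum f l -> has_usum g l' -> has_usum (fun i => f i + g i) (l + l').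
Proof.
move=> hf hg e e0.
have e20 : 0 < e / 2 by rewrite divr_gt0.
have [A hA] := hf _ e20; have [A' hA'] := hg _ e20.
exists (A ++ A') => B uB AB.
rewrite big_split/= opprD addrACA (le_lt_trans (ler_normD _ _))// [ltRHS]splitr.
rewrite ltrD//; [apply: hA|apply: hA'] => // x xA; apply: AB; rewrite mem_cat xA ?orbT//.
Qed.

Lemma has_usumZ (I : eqType) (f : I -> K) l c :
  has_usum f l -> has_usum (fun i => c * f i) (c * l).
Proof.
move=> hf; have [->|c0] := eqVneq c 0.
  by rewrite mul0r; apply: eq_has_usum (@has_usum0 I) => i; rewrite mul0r.
move=> e e0; have ec0 : 0 < e / `|c| by rewrite divr_gt0// normr_gt0.
have [A hA] := hf _ ec0; exists A => B uB AB.
by rewrite -mulr_sumr -mulrBr normrM mulrC -ltr_pdivlMr ?normr_gt0// hA.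
Qed.

Lemma has_usum_sum (I : eqType) (J : Type) (s : seq J) (f : J -> I -> K)
    (l : J -> K) : (forall j, has_usum (f j) (l j)) ->
  has_usum (fun i => \sum_(j <- s) f j i) (\sum_(j <- s) l j).
Proof.
move=> h; elim: s => [|j s IH].
  by rewrite big_nil; apply: eq_has_usum (@has_usum0 I) => i; rewrite big_nil.
rewrite big_cons; apply: eq_has_usum (has_usumD (h j) IH) => i.
by rewrite big_cons.
Qed.

Lemma has_usum_reindex (I J : eqType) (f : I -> K) l (h : J -> I) (h' : I -> J) :
  cancel h h' -> cancel h' h -> has_usum f l -> has_usum (f \o h) l.
Proof.
move=> hK h'K hf e e0; have [A hA] := hf e e0; exists (map h' A) => B uB AB.
have := hA (map h B); rewrite big_map; apply.
  by rewrite map_inj_uniq//; exact: can_inj hK.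
move=> x xA; rewrite -(h'K x) map_f// AB// map_f//.
Qed.

Lemma has_usum_finType (I : finType) (f : I -> K) : has_usum f (\sum_i f i).
Proof.
move=> e e0; exists (enum I) => B uB AB.
rewrite (perm_big (enum I)) ?big_enum/= ?subrr ?normr0//.
by apply: uniq_perm; rewrite ?enum_uniq// => x; rewrite AB mem_enum.
Qed.

(** Fubini, from joint to iterated sums. For a finite set of rows, one finite set of columns is
    chosen that is large enough for [A] and for each of these rows. *)
Lemma has_usum_fst (I J : eqType) (f : I * J -> K) (r : I -> K) l :
  has_usum f l -> (forall i, has_usum (fun j => f (i, j)) (r i)) ->
  has_usum r l.
Proof.
move=> hf hr e e0.
have e20 : 0 < e / 2 by rewrite divr_gt0.
have [A hA] := hf _ e20; exists (map fst A) => B uB AB.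
(* The successor keeps the tolerance per row positive when [B] is empty. *)
pose n : K := (size B).+1%:R.
have n0 : 0 < n by rewrite ltr0n.
have eB0 : 0 < e / 2 / n by rewrite divr_gt0.
have [T hT] := choice (fun i => hr i _ eB0).
pose C := undup (map snd A ++ flatten (map T B)).
have uC : uniq C by exact: undup_uniq.
have TC i : i \in B -> {subset T i <= C}.
  move=> iB x xT; rewrite mem_undup mem_cat; apply/orP; right.
  by apply/flatten_mapP; exists i.
have h1 : `|\sum_(i <- B) \sum_(j <- C) f (i, j) - l| < e / 2.
  have := hA [seq (i, j) | i <- B, j <- C]; rewrite big_allpairs; apply.
    by rewrite allpairs_uniq// => -[? ?] [? ?].
  move=> [i j] ijA; apply/allpairsP; exists (i, j) => /=; split => //.
    by rewrite AB//; apply/mapP; exists (i, j).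
  by rewrite mem_undup mem_cat; apply/orP; left; apply/mapP; exists (i, j).
have h2 : `|\sum_(i <- B) r i - \sum_(i <- B) \sum_(j <- C) f (i, j)| <= e / 2.
  rewrite -sumrB (le_trans (ler_norm_sum _ _ _))//.
  rewrite (@le_trans _ _ (\sum_(i <- B) e / 2 / n))//.
    rewrite big_seq [leRHS]big_seq; apply: ler_sum => i iB.
    by rewrite distrC ltW// hT//; exact: TC.
  rewrite big_const_seq iter_addr_0 count_predT.
  rewrite -[leLHS]mulr_natr -[leLHS]mulrA -[leRHS]mulr1 ler_pM2l//.
  by rewrite mulrC ler_pdivrMr// mul1r ler_nat.
rewrite -(subrKA (\sum_(i <- B) \sum_(j <- C) f (i, j))).
by rewrite (le_lt_trans (ler_normD _ _))// [ltRHS]splitr ler_ltD.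
Qed.

Lemma has_usum_snd (I J : eqType) (f : I * J -> K) (r : J -> K) l :
  has_usum f l -> (forall j, has_usum (fun i => f (i, j)) (r j)) ->
  has_usum r l.
Proof.
move=> hf hr.
pose sw (p : J * I) := (p.2, p.1); pose sw' (p : I * J) := (p.2, p.1).
have sK : cancel sw sw' by case.
have s'K : cancel sw' sw by case.
exact: has_usum_fst (has_usum_reindex sK s'K hf) hr.
Qed.

(** Summability of the product family is assumed; Fubini identifies its value. *)
Lemma has_usumM (I J : eqType) (f : I -> K) (g : J -> K) l l' L :
  has_usum (fun p : I * J => f p.1 * g p.2) L ->
  has_usum f l -> has_usum g l' -> L = l * l'.
Proof.
move=> hL hf hg.
have h1 : has_usum (fun i => f i * l') L.
  by apply: has_usum_fst hL _ => i; exact: (has_usumZ (f i) hg).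
apply: has_usum_unique h1 _; rewrite mulrC.
by apply: eq_has_usum (has_usumZ l' hf) => i; rewrite mulrC.
Qed.

Definition seq_lim (u : nat -> K) (l : K) : Prop :=
  forall e, 0 < e -> exists N, forall n, (N <= n)%N -> `|u n - l| < e.

Lemma seq_lim_unique u l l' : seq_lim u l -> seq_lim u l' -> l = l'.
Proof.
move=> hl hl'; apply/eqP; rewrite -subr_eq0 -normr_le0.
apply/ler_addgt0Pl => e e0; rewrite addr0.
have e20 : 0 < e / 2 by rewrite divr_gt0.
have [N hN] := hl _ e20; have [N' hN'] := hl' _ e20.
rewrite -(subrKA (u (maxn N N'))) (le_trans (ler_normD _ _))// [leRHS]splitr lerD// ltW//.
  by rewrite distrC hN// leq_maxl.
by rewrite hN'// leq_maxr.
Qed.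

Lemma eq_seq_lim u v l : (exists N, forall n, (N <= n)%N -> u n = v n) ->
  seq_lim u l -> seq_lim v l.
Proof.
move=> [N uv] hu e e0; have [N' hN'] := hu e e0.
exists (maxn N N') => n; rewrite geq_max => /andP[Nn N'n].
by rewrite -uv// hN'.
Qed.

Lemma seq_lim_sum (I : Type) (s : seq I) (u : nat -> I -> K) (l : I -> K) :
  (forall i, seq_lim (u ^~ i) (l i)) ->
  seq_lim (fun n => \sum_(i <- s) u n i) (\sum_(i <- s) l i).
Proof.
move=> h; elim: s => [|i s IH].
  by move=> e e0; exists 0%N => n _; rewrite !big_nil subrr normr0.
move=> e e0; have e20 : 0 < e / 2 by rewrite divr_gt0.
have [N hN] := h i _ e20; have [N' hN'] := IH _ e20.
exists (maxn N N') => n; rewrite geq_max => /andP[Nn N'n].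
rewrite !big_cons opprD addrACA (le_lt_trans (ler_normD _ _))// [ltRHS]splitr.
by rewrite ltrD// ?hN ?hN'.
Qed.

Lemma seq_limM (u v : nat -> K) l l' :
  seq_lim u l -> seq_lim v l' -> seq_lim (fun n => u n * v n) (l * l').
Proof.
move=> hu hv e e0.
have [N1 hN1] := hu 1 ltr01.
pose M := `|l| + 1 + `|l'| + 1.
have M0 : 0 < M by rewrite /M ltr_wpDl// !addr_ge0.
have eM0 : 0 < e / 2 / M by rewrite !divr_gt0.
have [N2 hN2] := hu _ eM0; have [N3 hN3] := hv _ eM0.
exists (maxn N1 (maxn N2 N3)) => n; rewrite !geq_max => /and3P[n1 n2 n3].
have -> : u n * v n - l * l' = u n * (v n - l') + (u n - l) * l' by ring.
rewrite (le_lt_trans (ler_normD _ _))// [ltRHS]splitr ltr_leD// normrM.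
  have uM : `|u n| <= M.
    rewrite -[u n](subrK l) (le_trans (ler_normD _ _))//.
    by rewrite /M -!addrA [leLHS]addrC lerD2l ler_wpDr ?addr_ge0// ltW// hN1.
  rewrite (le_lt_trans (ler_wpM2r _ uM))// mulrC -ltr_pdivlMr//; exact: hN3.
have lM : `|l'| <= M by rewrite /M -addrA ler_wpDl ?addr_ge0// ler_wpDr.
by rewrite (le_trans (ler_wpM2l _ lM))// -ler_pdivlMr// ltW// hN2.
Qed.

Lemma sum_subset_split (I : eqType) (A B : seq I) (G : I -> K) :
  uniq A -> uniq B -> {subset A <= B} ->
  \sum_(i <- B) G i = \sum_(i <- A) G i + \sum_(i <- B | i \notin A) G i.
Proof.
move=> uA uB AB; rewrite (bigID (mem A))/=; congr (_ + _).
rewrite -big_filter; apply: perm_big; apply: uniq_perm => //.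
  exact: filter_uniq.
by move=> x; rewrite mem_filter; case: (boolP (x \in A)) => // /AB ->.
Qed.

(** Dominated convergence for unordered sums: a finite set [A] carries almost all of the majorant,
    and on [A] the limit is a finite sum of limits. The bound on [F n] is asked from a rank on, as
    that is how the estimates for binomials and cosines hold. *)
Lemma tannery (I : eqType) (F : nat -> I -> K) (F0 : I -> K)
    (S : nat -> K) S0 (g : I -> K) s :
  (exists N, forall n, (N <= n)%N -> forall i, `|F n i| <= g i) ->
  (forall i, `|F0 i| <= g i) -> has_usum g s ->
  (forall i, seq_lim (F ^~ i) (F0 i)) ->
  (forall n, has_usum (F n) (S n)) -> has_usum F0 S0 ->
  seq_lim S S0.
Proof.
move=> [N FN] F0g gs FF0 FS F0S e e0.
(* Off [A] each of the two sums costs [3 d] (tail of the majorant [2 d], truncation [d]); the finite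
   sums over [A] cost the seventh. *)
pose d := e / 7.
have d0 : 0 < d by rewrite divr_gt0.
have [A0 hA0] := gs _ d0.
pose A := undup A0.
have uA : uniq A by exact: undup_uniq.
have hA B : uniq B -> {subset A <= B} -> `|\sum_(i <- B) g i - s| < d.
  by move=> uB AB; apply: hA0 => // x xA; rewrite AB// mem_undup.
have tail B : uniq B -> {subset A <= B} ->
    \sum_(i <- B | i \notin A) g i <= d + d.
  move=> uB AB; rewrite -[leLHS]ger0_norm; last first.
    by apply: sumr_ge0 => i _; exact: le_trans (F0g i).
  have -> : \sum_(i <- B | i \notin A) g i =
     (\sum_(i <- B) g i - s) - (\sum_(i <- A) g i - s).
    by rewrite (sum_subset_split _ uA uB AB); ring.
  by rewrite (le_trans (ler_normB _ _))// lerD// ltW// hA.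
have cmp (G : I -> K) L : (forall i, `|G i| <= g i) -> has_usum G L ->
    `|L - \sum_(i <- A) G i| <= d + d + d.
  move=> Gg GL; have [T hT] := GL _ d0.
  pose B := undup (A ++ T).
  have uB : uniq B := undup_uniq _.
  have AB : {subset A <= B} by move=> x xA; rewrite mem_undup mem_cat xA.
  have TB : {subset T <= B} by move=> x xA; rewrite mem_undup mem_cat xA orbT.
  have -> : L - \sum_(i <- A) G i =
     \sum_(i <- B | i \notin A) G i - (\sum_(i <- B) G i - L).
    by rewrite (sum_subset_split _ uA uB AB); ring.
  rewrite (le_trans (ler_normB _ _))// lerD//; last by rewrite ltW// hT.
  rewrite (le_trans (ler_norm_sum _ _ _))// (le_trans _ (tail _ uB AB))//.
  by apply: ler_sum => i _.
have [N' hN'] := @seq_lim_sum _ A F F0 FF0 _ d0.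
exists (maxn N N') => n; rewrite geq_max => /andP[Nn N'n].
have -> : S n - S0 = (S n - \sum_(i <- A) F n i) - (S0 - \sum_(i <- A) F0 i) +
  (\sum_(i <- A) F n i - \sum_(i <- A) F0 i) by ring.
have -> : e = (d + d + d) + (d + d + d) + d by rewrite /d; field.
rewrite (le_lt_trans (ler_normD _ _))// ler_ltD ?hN'//.
rewrite (le_trans (ler_normB _ _))// lerD//; first by apply: cmp => //; exact: FN.
exact: cmp.
Qed.

End UnorderedSums.

(** * Absolute summability and complex-valued families *)

Section Summability.
Variable R : realType.

Definition bounded_sums (I : eqType) (g : I -> R) : Prop :=
  (forall i, 0 <= g i) /\
  exists K, forall B : seq I, uniq B -> \sum_(i <- B) g i <= K.

Lemma bounded_sums_le (I : eqType) (f g : I -> R) :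
  (forall i, 0 <= f i) -> (forall i, f i <= g i) ->
  bounded_sums g -> bounded_sums f.
Proof.
move=> f0 fg [_ [K hK]]; split=> //; exists K => B uB.
by rewrite (le_trans _ (hK _ uB))//; apply: ler_sum => i _.
Qed.

Lemma bounded_sumsZ (I : eqType) (g : I -> R) c :
  0 <= c -> bounded_sums g -> bounded_sums (fun i => c * g i).
Proof.
move=> c0 [g0 [K hK]]; split=> [i|]; first by rewrite mulr_ge0.
by exists (c * K) => B uB; rewrite -mulr_sumr ler_wpM2l// hK.
Qed.

Lemma bounded_sumsM (I J : eqType) (f : I -> R) (g : J -> R) :
  bounded_sums f -> bounded_sums g ->
  bounded_sums (fun p : I * J => f p.1 * g p.2).
Proof.
move=> [f0 [K hK]] [g0 [L hL]]; split=> [p|]; first by rewrite mulr_ge0.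
exists (K * L) => B uB.
pose B1 := undup (map fst B); pose B2 := undup (map snd B).
have uX : uniq [seq (i, j) | i <- B1, j <- B2].
  by rewrite allpairs_uniq ?undup_uniq// => -[? ?] [? ?].
have BX : {subset B <= [seq (i, j) | i <- B1, j <- B2]}.
  move=> [i j] ijB; apply/allpairsP; exists (i, j) => /=; split => //.
    by rewrite mem_undup; apply/mapP; exists (i, j).
  by rewrite mem_undup; apply/mapP; exists (i, j).
apply: (@le_trans _ _ (\sum_(p <- [seq (i, j) | i <- B1, j <- B2]) f p.1 * g p.2)).
  rewrite (sum_subset_split _ uB uX BX) lerDl.
  by apply: sumr_ge0 => p _; rewrite mulr_ge0.
rewrite big_allpairs/=; under eq_bigr do rewrite -mulr_sumr.
rewrite -mulr_suml ler_pM ?sumr_ge0//.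
  by rewrite hK ?undup_uniq.
by rewrite hL ?undup_uniq.
Qed.

(** Split [B] into fibres over the finite index and add their bounds. This later adjoins the
    residues [m] to the lattice sums. *)
Lemma bounded_sums_finM (I : finType) (J : eqType) (g : I -> J -> R) :
  (forall i, bounded_sums (g i)) ->
  bounded_sums (fun p : I * J => g p.1 p.2).
Proof.
move=> hg; split=> [p|]; first exact: (hg p.1).1.
have [K hK] := choice (fun i => (hg i).2).
exists (\sum_i K i) => B uB.
rewrite (partition_big fst predT)//=; apply: ler_sum => i _.
rewrite -big_filter (eq_big_seq (fun p => g i p.2)); last first.
  by move=> p; rewrite mem_filter => /andP[/eqP ->].
rewrite -(big_map snd predT); apply: hK.
rewrite map_inj_in_uniq ?filter_uniq// => -[i1 j1] [i2 j2].
by rewrite !mem_filter/= => /andP[/eqP -> _] /andP[/eqP -> _] ->.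
Qed.

Lemma bounded_sums_ex (I : eqType) (g : I -> R) :
  bounded_sums g -> exists l, has_usum g l.
Proof.
move=> [g0 [K hK]].
pose S : set R := [set x | exists2 B : seq I, uniq B & x = \sum_(i <- B) g i]%classic.
have hS : has_sup S.
  split; first by exists 0; exists [::]; rewrite ?big_nil.
  by exists K => _ [B uB ->]; exact: hK.
exists (sup S) => e e0.
have [_ [A uA ->] hA] := sup_adherent e0 hS.
exists A => B uB AB.
have hB : \sum_(i <- B) g i <= sup S by apply: ub_le_sup; [exact: hS.2|exists B].
rewrite distrC ger0_norm ?subr_ge0// ltrBlDr -ltrBlDl (lt_le_trans hA)//.
by rewrite (sum_subset_split _ uA uB AB) lerDl sumr_ge0.
Qed.

(** [u + g] lies between 0 and [2 g], hence is summable as a nonnegative family; then subtract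
    [g]. *)
Lemma dominated_usum_real (I : eqType) (u g : I -> R) :
  (forall i, `|u i| <= g i) -> bounded_sums g -> exists l, has_usum u l.
Proof.
move=> ug bg.
have [l hl] := bounded_sums_ex bg.
have [|l' hl'] := @bounded_sums_ex I (fun i => u i + g i).
  apply: (@bounded_sums_le _ _ (fun i => 2 * g i)); last exact: bounded_sumsZ.
    by move=> i; have := ug i; rewrite ler_norml => /andP[]; lra.
  by move=> i; have := ug i; rewrite ler_norml => /andP[]; lra.
exists (l' + -1 * l); apply: eq_has_usum (has_usumD hl' (has_usumZ (-1) hl)) => i.
by ring.
Qed.

Lemma normC_real (x : R) : `|x%:C| = `|x|%:C.
Proof. by rewrite normc_def/= expr0n/= addr0 sqrtr_sqr. Qed.

(** In the partial order of [R[i]] a positive number is real, so a complex tolerance is a real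
    one. *)
Lemma gt0_complexE (e : R[i]) : 0 < e -> e = (complex.Re e)%:C /\ 0 < complex.Re e.
Proof. by case: e => a b; rewrite ltcE/= => /andP[/eqP -> ->]. Qed.

Lemma has_usum_real_complex (I : eqType) (u : I -> R) l :
  has_usum u l -> has_usum (fun i => (u i)%:C) l%:C.
Proof.
move=> hu e /gt0_complexE[-> e0]; have [A hA] := hu _ e0; exists A => B uB AB.
by rewrite -rmorph_sum -rmorphB/= normC_real ltcR hA.
Qed.

Lemma complex_ReIm (z : R[i]) :
  z = (complex.Re z)%:C + 'i * (complex.Im z)%:C.
Proof. by case: z => a b; simpc. Qed.

Lemma has_usum_complex (I : eqType) (f : I -> R[i]) a b :
  has_usum (fun i => complex.Re (f i)) a ->
  has_usum (fun i => complex.Im (f i)) b -> has_usum f (a +i* b).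
Proof.
move=> ha hb; rewrite (complex_ReIm (a +i* b))/=.
apply: eq_has_usum (has_usumD (has_usum_real_complex ha)
  (has_usumZ 'i (has_usum_real_complex hb))) => i.
by rewrite [RHS]complex_ReIm.
Qed.

Lemma Re_le_norm (z : R[i]) c : `|z| <= c%:C -> `|complex.Re z| <= c.
Proof.
move=> h; rewrite -lecR (le_trans _ h)// normc_def lecR -sqrtr_sqr ler_wsqrtr//.
by rewrite lerDl sqr_ge0.
Qed.

Lemma Im_le_norm (z : R[i]) c : `|z| <= c%:C -> `|complex.Im z| <= c.
Proof.
move=> h; rewrite -lecR (le_trans _ h)// normc_def lecR -sqrtr_sqr ler_wsqrtr//.
by rewrite lerDr sqr_ge0.
Qed.

Lemma dominated_usum (I : eqType) (f : I -> R[i]) (g : I -> R) :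
  (forall i, `|f i| <= (g i)%:C) -> bounded_sums g -> exists l, has_usum f l.
Proof.
move=> fg bg.
have [a ha] := dominated_usum_real (fun i => Re_le_norm (fg i)) bg.
have [b hb] := dominated_usum_real (fun i => Im_le_norm (fg i)) bg.
by exists (a +i* b); exact: has_usum_complex.
Qed.

Lemma seq_lim_cvg (u : nat -> R) (l : R) :
  (u @ \oo --> l)%classic -> seq_lim u l.
Proof.
move=> /cvgrPdistC_lt h e e0; have [N _ hN] := h _ e0.
by exists N => n Nn; exact: hN.
Qed.

Lemma seq_lim_real_complex (u : nat -> R) l :
  seq_lim u l -> seq_lim (fun n => (u n)%:C) l%:C.
Proof.
move=> hu e /gt0_complexE[-> e0]; have [N hN] := hu _ e0; exists N => n Nn.
by rewrite -rmorphB/= normC_real ltcR hN.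
Qed.

Lemma seq_lim_cst (K : numFieldType) (c : K) : seq_lim (fun _ => c) c.
Proof. by move=> e e0; exists 0%N => n _; rewrite subrr normr0. Qed.

Lemma seq_limD (K : numFieldType) (u v : nat -> K) a b :
  seq_lim u a -> seq_lim v b -> seq_lim (fun n => u n + v n) (a + b).
Proof.
move=> hu hv; have := @seq_lim_sum K bool [:: true; false]
  (fun n i => if i then u n else v n) (fun i => if i then a else b).
rewrite !big_cons big_nil addr0 => h.
apply: eq_seq_lim (h _); last by case.
by exists 0%N => n _; rewrite !big_cons big_nil addr0.
Qed.

Lemma seq_lim_expi (u : nat -> R) l :
  (u @ \oo --> l)%classic -> seq_lim (fun n => expi (u n)) (expi l).
Proof.
move=> hu; rewrite (complex_ReIm (expi l)).
apply: (@eq_seq_lim _ (fun n => (cos (u n))%:C + 'i * (sin (u n))%:C)).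
  by exists 0%N => n _; rewrite [RHS]complex_ReIm.
apply: seq_limD.
  by apply: seq_lim_real_complex; apply: seq_lim_cvg;
    apply: (cvg_comp _ _ hu); exact: continuous_cos.
apply: seq_limM; first exact: seq_lim_cst.
by apply: seq_lim_real_complex; apply: seq_lim_cvg;
    apply: (cvg_comp _ _ hu); exact: continuous_sin.
Qed.

Lemma norm_expi (t : R) : `|expi t| = 1.
Proof. by rewrite normc_def/= cos2Dsin2 sqrtr1. Qed.

Lemma expi0 : expi (0 : R) = 1.
Proof. by rewrite /expi cos0 sin0. Qed.

Lemma expiD (s t : R) : expi (s + t) = expi s * expi t.
Proof. by rewrite /expi cosD sinD; simpc; rewrite [X in _ +i* X]addrC. Qed.

Lemma expiMn (t : R) n : expi (t *+ n) = expi t ^+ n.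
Proof.
by elim: n => [|n IH]; rewrite ?mulr0n ?expi0// mulrS expiD IH exprS.
Qed.

Lemma expi_2pi : expi (pi *+ 2 : R) = 1.
Proof. by rewrite /expi cos2pi sin2pi. Qed.

Lemma expi_2piM (k : int) : expi (2 * pi * k%:~R : R) = 1.
Proof.
have h n : expi (2 * pi * n%:R : R) = 1.
  have -> : 2 * pi * n%:R = (pi *+ 2) *+ n :> R.
    by rewrite -(mulr_natr (pi *+ 2) n) -(mulr_natr pi 2); ring.
  by rewrite expiMn expi_2pi expr1n.
case: k => n; first exact: h.
rewrite NegzE -[LHS]mul1r -{1}(h n.+1) -expiD mulrNz mulrN pmulrn addrN.
exact: expi0.
Qed.

End Summability.

Section Conversion.
Variable K : numFieldType.

(** The threshold list becomes a finite set, and every larger finite set is enumerated by a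
    duplicate-free list. *)
Lemma has_usum_sumZ2 (f : int -> int -> K) l :
  has_usum (fun p : int * int => f p.1 p.2) l ->
  cvg_sumZ2 f /\ sumZ2 f = l.
Proof.
move=> hf; have FF := @summability.totally_filter (int * int)%type.
have h : (summability.partial_sum (fun a : int * int => f a.1 a.2 : K^o)
       @ summability.totally --> (l : K^o))%classic.
  apply/cvgrPdistC_lt => e e0; have [A hA] := hf e e0.
  exists [fset x in A]%fset => // B /= AB.
  rewrite /summability.partial_sum /=.
  rewrite -(big_seq_fsetE _ _ predT (fun a : int * int => f a.1 a.2))/=.
  apply: hA; first exact: fset_uniq.
  by move=> x xA; move/fsubsetP: AB; apply; rewrite inE.
split; first by apply/cvg_ex; exists l.
apply: (cvg_lim _ h); exact: norm_hausdorff.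
Qed.

End Conversion.

(** * Gaussian sums over the integers *)

Section GaussianSums.
Variable R : realType.

Lemma bounded_sums_nat_geometric (x : R) :
  0 <= x < 1 -> bounded_sums (fun k : nat => x ^+ k).
Proof.
move=> /andP[x0 x1]; split=> [k|]; first exact: exprn_ge0.
exists (1 - x)^-1 => B uB.
have BN : {subset B <= iota 0 (\max_(i <- B) i).+1}.
  by move=> i iB; rewrite mem_iota/= add0n ltnS; exact: leq_bigmax_seq.
apply: (@le_trans _ _ (\sum_(i <- iota 0 (\max_(i <- B) i).+1) x ^+ i)).
  rewrite (sum_subset_split _ uB (iota_uniq _ _) BN) lerDl.
  by apply: sumr_ge0 => i _; exact: exprn_ge0.
set N := (\max_(i <- B) i).+1.
have x10 : 0 < 1 - x by rewrite subr_gt0.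
rewrite -[leRHS]mul1r ler_pdivlMr// mulrC.
have -> : \sum_(i <- iota 0 N) x ^+ i = \sum_(i < N) x ^+ i.
  by rewrite -(big_mkord predT (fun i => x ^+ i)) /index_iota subn0.
have -> : (1 - x) * (\sum_(i < N) x ^+ i) = 1 - x ^+ N.
  by rewrite -(opprB x 1) mulNr -subrX1 opprB.
by rewrite gerBl exprn_ge0.
Qed.

Lemma bounded_sums_geometric (x : R) :
  0 <= x < 1 -> bounded_sums (fun M : int => x ^+ `|M|%N).
Proof.
move=> x01; have [x0 [K hK]] := bounded_sums_nat_geometric x01.
split=> [M|]; first exact: x0.
exists (K + K) => B uB; rewrite (bigID (fun M : int => 0 <= M))/=.
apply: lerD; rewrite -big_filter -(big_map absz predT (fun k => x ^+ k)); apply: hK;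
    rewrite map_inj_in_uniq ?filter_uniq// => i j; rewrite !mem_filter => /andP[+ _] /andP[+ _]; lia.
Qed.

(** From [|M| <= M ^ 2] for integers and [(M + 2 t) ^ 2 >= 0]. The ratio of the geometric majorant
    is free of [t], so the bound is uniform over bounded shifts. *)
Lemma gauss_le_geometric (A t : R) (M : int) : 0 <= A ->
  expR (- A * (M%:~R + t) ^+ 2) <= expR (A * t ^+ 2) * expR (- A / 2) ^+ `|M|%N.
Proof.
move=> A0; rewrite -expRM_natl -expRD ler_expR.
have MM : (`|M|%N%:R : R) <= M%:~R ^+ 2.
  by rewrite natr_absz -rmorphXn/= ler_int; nia.
have -> : A * t ^+ 2 + `|M|%N%:R * (- A / 2) =
  - A * (M%:~R + t) ^+ 2 + A / 2 * ((M%:~R + 2 * t) ^+ 2 + (M%:~R ^+ 2 - `|M|%N%:R)) by field.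
by rewrite lerDl mulr_ge0 ?divr_ge0// addr_ge0 ?sqr_ge0// subr_ge0.
Qed.

Lemma expR_lt1N (A : R) : 0 < A -> 0 <= expR (- A) < 1.
Proof. by move=> A0; rewrite expR_ge0/= expR_lt1 oppr_lt0. Qed.

Lemma bounded_sums_gauss (A t : R) : 0 < A ->
  bounded_sums (fun M : int => expR (- A * (M%:~R + t) ^+ 2)).
Proof.
move=> A0; apply: bounded_sums_le => [M|M|]; first exact: expR_ge0.
  exact: gauss_le_geometric (ltW A0).
apply: bounded_sumsZ; first exact: expR_ge0.
by apply: bounded_sums_geometric; rewrite mulNr expR_lt1N// divr_gt0.
Qed.

End GaussianSums.

(** * Sums supported on the range of an injection *)

Section Support.
Variables (K : numFieldType) (I J : eqType).
Variables (f : I -> K) (phi : J -> I) (psi : I -> J) (l : K).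
Hypotheses (phiK : cancel phi psi) (suppf : forall i, f i != 0 -> phi (psi i) = i).

(** As [f] vanishes off the range of [phi], [map phi B] can be enlarged to contain [A] without
    changing the sum. *)
Lemma has_usum_pull : has_usum f l -> has_usum (f \o phi) l.
Proof.
move=> hf e e0; have [A hA] := hf e e0; exists (map psi A) => B uB AB.
pose B1 := map phi B; pose B2 := undup (B1 ++ A).
have uB1 : uniq B1 by rewrite map_inj_uniq//; exact: can_inj phiK.
have uB2 : uniq B2 := undup_uniq _.
have B12 : {subset B1 <= B2} by move=> i iB; rewrite mem_undup mem_cat iB.
have -> : \sum_(j <- B) (f \o phi) j = \sum_(i <- B2) f i.
  rewrite (sum_subset_split f uB1 uB2 B12) big_map [X in _ + X]big1_seq ?addr0//.
  move=> i /andP[iB1]; rewrite mem_undup mem_cat (negPf iB1)/= => iA.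
  apply/eqP/negP => /negP fi0; move/negP: iB1; apply.
  by apply/mapP; exists (psi i); rewrite ?suppf// AB// map_f.
by apply: hA => // i iA; rewrite mem_undup mem_cat iA orbT.
Qed.

Lemma has_usum_push : has_usum (f \o phi) l -> has_usum f l.
Proof.
move=> hf e e0; have [A hA] := hf e e0; exists (map phi A) => B uB AB.
pose B1 := [seq i <- B | phi (psi i) == i].
have -> : \sum_(i <- B) f i = \sum_(j <- map psi B1) (f \o phi) j.
  rewrite big_map big_filter (bigID (fun i => phi (psi i) == i))/=.
  rewrite [X in _ + X]big1 ?addr0; last first.
    by move=> i ip; apply/eqP/negP => /negP /suppf pi; rewrite pi eqxx in ip.
  by apply: eq_bigr => i /eqP ->.
apply: hA.
  rewrite map_inj_in_uniq ?filter_uniq// => i i'.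
  by rewrite !mem_filter => /andP[/eqP hi _] /andP[/eqP hi' _] ii'; rewrite -hi ii'.
move=> j jA; apply/mapP; exists (phi j); last by rewrite phiK.
by rewrite mem_filter phiK eqxx/= AB// map_f.
Qed.

End Support.

(** * Elementary limits *)

Section RealLimits.
Variable R : realType.
Local Open Scope classical_set_scope.

(** Squeeze by [1 + x <= expR x], taken at [x = - u] for the upper bound and at [x = u / (1 - u)],
    then inverted, for the lower one. *)
Lemma cvg_1BX (u : nat -> R) (m : nat -> nat) (L : R) :
  (forall n, 0 <= u n) -> u @ \oo --> (0 : R) ->
  (fun n => (m n)%:R * u n) @ \oo --> L ->
  (fun n => (1 - u n) ^+ m n) @ \oo --> expR (- L).
Proof.
move=> u0 ucv mu.
have lo : (fun n => expR (- ((m n)%:R * u n * (1 - u n)^-1))) @ \oo --> expR (- L).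
  apply: continuous_cvg; first exact: continuous_expR.
  apply: cvgN; rewrite -[X in _ --> X]mulr1; apply: cvgM => //.
  rewrite -[X in _ --> X]invr1; apply: cvgV; first exact: oner_neq0.
  by rewrite -[X in _ --> X]subr0; apply: cvgB => //; exact: cvg_cst.
have hi : (fun n => expR (- ((m n)%:R * u n))) @ \oo --> expR (- L).
  by apply: continuous_cvg; [exact: continuous_expR|exact: cvgN].
apply: squeeze_cvgr lo hi; near=> n.
have u1 : u n < 1 by near: n; exact: (cvgr_lt _ ucv).
have v0 : 0 < 1 - u n by rewrite subr_gt0.
apply/andP; split=> /=.
  rewrite -mulrA -mulrN expRM_natl lerXn2r ?nnegrE ?expR_ge0// ?(ltW v0)//.
  rewrite expRN -[leRHS]invrK lef_pV2 ?posrE ?invr_gt0 ?expR_gt0//.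
  rewrite (le_trans _ (expR_ge1Dx _))// le_eqVlt; apply/orP; left; apply/eqP.
  by field; rewrite gt_eqF.
rewrite -mulrN expRM_natl lerXn2r ?nnegrE ?expR_ge0// ?(ltW v0)//.
exact: expR_ge1Dx.
Unshelve. all: by end_near. Qed.

Lemma cvg_sin_div (v : nat -> R) (c : R) :
  (forall n, v n != 0) -> v @ \oo --> (0 : R) ->
  (fun n => (v n)^-1 * sin (c * v n)) @ \oo --> c.
Proof.
move=> v0 vcv; have /is_derive1_caratheodory[g [sing cg g0]] := is_derive_sin (0 : R).
have -> : (fun n => (v n)^-1 * sin (c * v n)) = (fun n => c * g (c * v n)).
  apply/funext => n; have := sing (c * v n); rewrite sin0 !subr0 => ->.
  by field.
have -> : nbhs c = nbhs (c * g 0) by rewrite g0 cos0 mulr1.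
apply: cvgM; first exact: cvg_cst.
have h : (fun n => c * v n) @ \oo --> (0 : R).
  by rewrite -[X in _ --> X](mulr0 c); apply: cvgM; first exact: cvg_cst.
by apply: continuous_cvg; [exact: cg|exact: h].
Qed.

End RealLimits.

(** * Polya's identity *)

Section FiniteFourier.
Variable R : realType.

Lemma double_cos_expi (x : R) : (2 * cos x)%:C = expi x + expi (- x).
Proof. by rewrite /expi cosN sinN; apply/eqP; rewrite eq_complex/=; apply/andP; split; apply/eqP; ring. Qed.

Lemma expi_scale (x : R) (k : int) : expi (2 * pi * (k%:~R + x)) = expi (2 * pi * x).
Proof. by rewrite mulrDr expiD expi_2piM mul1r. Qed.

(** Binomial expansion of an even power of [expi x + expi (- x)], with the index centred by
    [k = m - i]. The coefficients vanish for [|k| > m], and their symmetry allows [|k|]. *)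
Lemma has_usum_cosX (m : nat) (x : R) :
  has_usum (fun k : int => 'C(2 * m, m + `|k|%N)%:R * expi (2 * x * k%:~R))
    ((2 * cos x) ^+ (2 * m))%:C.
Proof.
pose phi (i : 'I_(2 * m).+1) : int := m%:Z - i%:Z.
pose psi (k : int) : 'I_(2 * m).+1 := inord `|(m%:Z - k)|%N.
apply: (@has_usum_push _ _ _ _ phi psi).
- move=> i; have := ltn_ord i; move=> im.
  by apply/val_inj; rewrite /psi /phi /= inordK; lia.
- move=> k; rewrite mulf_eq0 negb_or => /andP[+ _]; rewrite pnatr_eq0 -lt0n bin_gt0 => hk.
  by rewrite /phi /psi inordK; lia.
have -> : ((2 * cos x) ^+ (2 * m))%:C = \sum_(i < (2 * m).+1)
    ((fun k : int => 'C(2 * m, m + `|k|%N)%:R * expi (2 * x * k%:~R)) \o phi) i.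
  rewrite rmorphXn/= double_cos_expi exprDn; apply: eq_bigr => i _ /=.
  have i2m : (i <= 2 * m)%N by rewrite -ltnS.
  rewrite -!expiMn -expiD -[LHS]mulr_natl; congr (_%:R * expi _).
    have [im|im] := leqP i m.
      have -> : (m + `|phi i|)%N = (2 * m - i)%N by rewrite /phi; lia.
      by rewrite bin_sub.
    by have -> : (m + `|phi i|)%N = i by rewrite /phi; lia.
  rewrite /phi mulNrn -(mulr_natr x i) -(mulr_natr x (_ - _)) natrB// rmorphB/= -!pmulrn natrM; ring.
exact: has_usum_finType.
Qed.

(** With [j] the residue of [s], [pi * j / n] lies strictly between 0 and [pi], so its sine is
    non-zero and the cosine of the double angle is below 1. *)
Lemma expi_neq1 (n : nat) (s : int) : (0 < n)%N -> ~~ (n%:Z %| s)%Z ->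
  expi (2 * pi * (s%:~R / n%:R) : R) != 1.
Proof.
move=> n0 ns; have nZ0 : n%:Z != 0 by rewrite eqz_nat -lt0n.
have nR0 : (0 : R) < n%:R by rewrite ltr0n.
have -> : s%:~R / n%:R = (s %/ n)%Z%:~R + (s %% n)%Z%:~R / n%:R :> R.
  by rewrite {1}(divz_eq s n) rmorphD rmorphM/= -pmulrn; field; rewrite gt_eqF.
rewrite expi_scale; set j := (s %% n)%Z.
have j0 : 0 < j by rewrite lt0r modz_ge0// andbT; apply: contra ns => /eqP /dvdz_mod0P.
have jn : j < n by rewrite ltz_pmod.
have s0 : 0 < sin (pi * (j%:~R / n%:R) : R).
  apply: sin_gt0_pi; rewrite mulr_gt0 ?pi_gt0 ?divr_gt0 ?ltr0z//=.
  by rewrite gtr_pMr ?pi_gt0// ltr_pdivrMr// mul1r pmulrn ltr_int.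
apply/negP => /eqP[+ _].
rewrite -mulrA [2 * _]mulr_natl cos_mulr2n cos2sin2 => h.
have : sin (pi * (j%:~R / n%:R) : R) ^+ 2 = 0 by move: h; set a := sin _; lra.
by move/eqP; rewrite sqrf_eq0 gt_eqF.
Qed.

(** Orthogonality of characters modulo [n], used as a filter that keeps the multiples of [n]; the
    offset [x] factors out as a phase. *)
Lemma sum_expi_roots (n : nat) (s : int) (x : R) : (0 < n)%N ->
  \sum_(q < n) expi (2 * pi * ((q%:R + x) * (s%:~R / n%:R))) =
  if (n%:Z %| s)%Z then n%:R * expi (2 * pi * (x * (s%:~R / n%:R))) else 0.
Proof.
move=> n0; have nR0 : (n%:R : R) != 0 by rewrite pnatr_eq0 -lt0n.
pose z := expi (2 * pi * (s%:~R / n%:R) : R).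
have -> : \sum_(q < n) expi (2 * pi * ((q%:R + x) * (s%:~R / n%:R))) =
    expi (2 * pi * (x * (s%:~R / n%:R))) * \sum_(q < n) z ^+ q.
  rewrite mulr_sumr; apply: eq_bigr => q _; rewrite -expiMn -expiD.
  by rewrite -(mulr_natr (2 * pi * (s%:~R / n%:R)) q); congr expi; ring.
case: ifPn => [|ns].
  move=> /dvdzP[k sk].
  have -> : z = 1.
    by rewrite /z sk rmorphM/= -pmulrn mulfK// expi_2piM.
  under eq_bigr do rewrite expr1n.
  by rewrite sumr_const card_ord mulrC.
apply/eqP; rewrite mulf_eq0; apply/orP; right.
have := subrX1 z n; rewrite -expiMn -(mulr_natr (2 * pi * (s%:~R / n%:R)) n).
rewrite -mulrA divfK// expi_2piM subrr.
by move/esym/eqP; rewrite mulf_eq0 subr_eq0 (negPf (expi_neq1 n0 ns)).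
Qed.

(* Both sides are the sum over q of the Fourier series of (2 cos)^(2m) at
   pi (q + y) / n. *)
Lemma polya_identity (n m : nat) (r : int) (y : R) : (0 < n)%N ->
  has_usum (fun M : int => n%:R * 'C(2 * m, m + `|(n%:Z * M + r)%R|%N)%:R *
              expi (2 * pi * (- y * M%:~R)))
    (\sum_(q < n) ((2 * cos (pi * ((q%:R + y) / n%:R))) ^+ (2 * m))%:C *
       expi (2 * pi * ((q%:R + y) * (r%:~R / n%:R)))).
Proof.
move=> n0; have nR0 : (n%:R : R) != 0 by rewrite pnatr_eq0 -lt0n.
have nZ0 : n%:Z != 0 by rewrite eqz_nat -lt0n.
(* What is left of the Fourier term at [k] after summation over [q]: the roots of unity keep the [k]
   congruent to [- r]. *)
pose f (k : int) : R[i] := 'C(2 * m, m + `|k|%N)%:R *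
  (if (n%:Z %| k + r)%Z then n%:R * expi (2 * pi * (y * ((k + r)%:~R / n%:R))) else 0).
(* Enumerates those [k]. The minus sign is invisible to the binomial, which sees [|k|], and turns
   the phase into [- y * M]. *)
pose phi (M : int) : int := - (n%:Z * M + r).
pose psi (k : int) : int := - ((k + r) %/ n)%Z.
have hf : has_usum f (\sum_(q < n) ((2 * cos (pi * ((q%:R + y) / n%:R))) ^+ (2 * m))%:C *
       expi (2 * pi * ((q%:R + y) * (r%:~R / n%:R)))).
  under eq_bigr do rewrite mulrC.
  apply: eq_has_usum (has_usum_sum _ (fun q : 'I_n => has_usumZ _ (has_usum_cosX m _))) => k.
  rewrite /f -sum_expi_roots// mulr_sumr; apply: eq_bigr => q _.
  rewrite mulrCA; congr (_ * _); rewrite -expiD; congr expi.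
  by rewrite rmorphD/=; field.
apply: eq_has_usum (has_usum_pull (phi := phi) (psi := psi) _ _ hf).
- move=> M; rewrite /f /phi /=.
  have -> : - (n%:Z * M + r) + r = (- M) * n%:Z by ring.
  rewrite dvdz_mull// abszN mulrCA !mulrA; congr (_ * expi _).
  by rewrite rmorphM rmorphN/= -pmulrn; field.
- move=> M; rewrite /psi /phi.
  have -> : - (n%:Z * M + r) + r = (- M) * n%:Z by ring.
  by rewrite mulzK// opprK.
- move=> k; rewrite /f; case: ifPn => [nk _|]; last by rewrite mulr0 eqxx.
  rewrite /phi /psi mulrN mulrC divzK//; ring.
Qed.

End FiniteFourier.

(** * Gaussian bounds for central binomial ratios *)

Section BinomialAsymptotics.
Variable R : realType.

Definition binom_ratio (m k : nat) : R := 'C(2 * m, m + k)%:R / 'C(2 * m, m)%:R.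

Lemma central_binom_gt0 m : (0 : R) < 'C(2 * m, m)%:R.
Proof. by rewrite ltr0n bin_gt0; lia. Qed.

Lemma binom_ratioS m k :
  binom_ratio m k.+1 * (m + k.+1)%:R = binom_ratio m k * (m - k)%:R.
Proof.
rewrite /binom_ratio mulrAC [RHS]mulrAC -!natrM addnS.
have := mul_bin_left (2 * m) (m + k); rewrite [in RHS]mulnC mulnC => ->.
by have -> : (2 * m - (m + k) = m - k)%N by lia.
Qed.

Lemma binom_ratio0 m : binom_ratio m 0 = 1.
Proof. by rewrite /binom_ratio addn0 divff// gt_eqF// central_binom_gt0. Qed.

Lemma binom_ratio_ge0 m k : 0 <= binom_ratio m k.
Proof. by rewrite divr_ge0. Qed.

Lemma binom_ratio_gt m k : (m < k)%N -> binom_ratio m k = 0.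
Proof. by move=> mk; rewrite /binom_ratio bin_small ?mul0r//; lia. Qed.

(** Each factor [(m - j) / (m + j + 1) = 1 - (2 j + 1) / (m + j + 1)] is at most
    [expR (- (2 j + 1) / (m + k))] for [j < k], and the odd numbers below [2 k] add up to
    [k ^ 2]. *)
Lemma binom_ratio_le m k : (k <= m)%N -> (0 < m)%N ->
  binom_ratio m k <= expR (- (k%:R ^+ 2 / (m%:R + k%:R))).
Proof.
move=> km m0.
have mk0 : (0 : R) < m%:R + k%:R by rewrite -natrD ltr0n addn_gt0 m0.
suff h j : (j <= k)%N -> binom_ratio m j <= expR (- (j%:R ^+ 2 / (m%:R + k%:R))).
  exact: h.
elim: j => [|j IH] jk; first by rewrite binom_ratio0 expr0n/= mul0r oppr0 expR0.
have mj0 : (0 : R) < (m + j.+1)%:R by rewrite ltr0n addnS.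
rewrite -(ler_pM2r mj0) binom_ratioS.
apply: (le_trans (ler_wpM2r (ler0n _ _) (IH (ltnW jk)))).
have -> : - (j.+1%:R ^+ 2 / (m%:R + k%:R)) =
  - (j%:R ^+ 2 / (m%:R + k%:R)) + - ((2 * j%:R + 1) / (m%:R + k%:R)) :> R.
  by rewrite -natr1; field; rewrite gt_eqF.
rewrite expRD -[leRHS]mulrA ler_wpM2l ?expR_ge0//.
rewrite natrB; last by lia.
rewrite -ler_pdivrMr// (le_trans _ (expR_ge1Dx _))//.
rewrite ler_pdivrMr// mulrDl mul1r natrD -natr1.
have : (2 * j%:R + 1) / (m%:R + k%:R) * (m%:R + (j%:R + 1)) <= (2 * j%:R + 1 : R).
  rewrite mulrAC ler_pdivrMr// ler_wpM2l ?addr_ge0 ?mulr_ge0//.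
  by rewrite lerD2l natr1 ler_nat.
by rewrite mulNr; lra.
Qed.

(** The same induction on the inverted factor [(m + j + 1) / (m - j) = 1 + (2 j + 1) / (m - j)],
    where [m - j >= m + 1 - k]. *)
Lemma binom_ratio_ge m k : (k <= m)%N ->
  expR (- (k%:R ^+ 2 / (m%:R + 1 - k%:R))) <= binom_ratio m k.
Proof.
move=> km.
have mk0 : (0 : R) < m%:R + 1 - k%:R by rewrite natr1 subr_gt0 ltr_nat ltnS.
suff h j : (j <= k)%N -> expR (- (j%:R ^+ 2 / (m%:R + 1 - k%:R))) <= binom_ratio m j.
  exact: h.
elim: j => [|j IH] jk; first by rewrite binom_ratio0 expr0n/= mul0r oppr0 expR0.
have mj0 : (0 : R) < (m + j.+1)%:R by rewrite ltr0n addnS.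
rewrite -(ler_pM2r mj0) binom_ratioS.
apply: (le_trans _ (ler_wpM2r (ler0n _ _) (IH (ltnW jk)))).
have -> : - (j.+1%:R ^+ 2 / (m%:R + 1 - k%:R)) =
  - (j%:R ^+ 2 / (m%:R + 1 - k%:R)) + - ((2 * j%:R + 1) / (m%:R + 1 - k%:R)) :> R.
  by rewrite -natr1; field; rewrite gt_eqF.
rewrite expRD -[leLHS]mulrA ler_wpM2l ?expR_ge0//.
have mj : (0 : R) < (m - j)%:R by rewrite ltr0n; lia.
rewrite expRN mulrC ler_pdivrMr ?expR_gt0//.
apply: (@le_trans _ _ ((m - j)%:R * (1 + (2 * j%:R + 1) / (m%:R + 1 - k%:R)))); last first.
  by rewrite ler_wpM2l ?expR_ge1Dx// ltW.
move: mj; rewrite natrB; last by lia.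
move=> mj; rewrite mulrDr mulr1 natrD -natr1.
have : (2 * j%:R + 1 : R) <= (m%:R - j%:R) * ((2 * j%:R + 1) / (m%:R + 1 - k%:R)).
  rewrite mulrA ler_pdivlMr// [leRHS]mulrC ler_wpM2l ?addr_ge0 ?mulr_ge0//.
  have : (j.+1%:R : R) <= k%:R by rewrite ler_nat.
  by rewrite -natr1; lra.
by lra.
Qed.

End BinomialAsymptotics.

(** * Comparison of the cosine with a Gaussian *)

Section TrigonometricBounds.
Variable R : realType.

(** Use [sin x = 2 cos (x / 2) sin (x / 2)] with [x / 2 <= pi / 4]: the cosine is at least
    [cos (pi / 4)], the sine at least [cos (pi / 4) * (x / 2)] by the mean value theorem, and
    [cos (pi / 4) ^ 2 = 1 / 2]. *)
Lemma sin_ge_half (x : R) : 0 <= x <= pi / 2 -> x / 2 <= sin x.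
Proof.
move=> /andP[x0 xpi]; have pi0 := pi_gt0 R.
have half (z : R) : 0 <= z <= pi / 4 -> cos (pi / 4) <= cos z.
  move=> /andP[z0 z4]; case: (ltgtP z (pi / 4)) => [h|h|->]//; last by lra.
  by rewrite ltW// ltr_cos// in_itv/=; lra.
have cos4 : cos (pi / 4 : R) ^+ 2 = 1 / 2.
  have := cos_mulr2n (pi / 4 : R).
  have -> : pi / 4 *+ 2 = pi / 2 :> R by rewrite -mulr_natr; field.
  by rewrite cos_pihalf; lra.
have c40 : 0 <= cos (pi / 4 : R) by apply: cos_ge0_pihalf; lra.
have mvt (z : R) : 0 <= z <= pi / 4 -> cos (pi / 4) * z <= sin z.
  move=> /andP[z0 z4].
  have [e ein] := @MVT_segment R sin cos 0 z z0 (fun x _ => is_derive_sin x)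
    (continuous_subspaceT (@continuous_sin R)).
  rewrite sin0 !subr0 => ->; rewrite ler_wpM2r// half//.
  by move: ein; rewrite in_itv/=; lra.
have -> : sin x = 2 * (cos (x / 2) * sin (x / 2)).
  by rewrite mulr_natl -sin_mulr2n -mulr_natr; congr sin; field.
have x2 : 0 <= x / 2 <= pi / 4 by lra.
apply: (@le_trans _ _ (2 * (cos (pi / 4) * (cos (pi / 4) * (x / 2))))).
  by rewrite [cos _ * (_ * _)]mulrA -expr2 cos4; lra.
rewrite ler_pM2l//; apply: ler_pM; [|by rewrite mulr_ge0//; lra|exact: half|exact: mvt].
by [].
Qed.

Lemma cos_sqr_le (x : R) : `|x| <= pi / 2 -> cos x ^+ 2 <= expR (- (x ^+ 2 / 4)).
Proof.
move=> xpi; rewrite cos2sin2 (le_trans _ (expR_ge1Dx _))// lerD2l lerN2.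
rewrite -(real_normK (num_real x)) -[sin x ^+ 2]real_normK ?num_real//.
have -> : `|x| ^+ 2 / 4 = (`|x| / 2) ^+ 2 by field.
rewrite lerXn2r ?nnegrE ?divr_ge0//.
rewrite (le_trans (sin_ge_half _)) ?normr_ge0//.
by case: (ger0P x) => _; rewrite ?sinN ?ler_norm// -normrN ler_norm.
Qed.

End TrigonometricBounds.

(** * Poisson summation for Gaussians *)

Section Poisson.
Variables (R : realType) (A : R).
Hypothesis A0 : 0 < A.
Local Open Scope classical_set_scope.

(** Scaling of Polya's identity: step [n], mesh [v = 1 / n], exponent [m] about [n ^ 2 / A], so that
    [mu = m / n ^ 2] tends to [1 / A]; the offset [r], about [n * t], makes [(n * M + r) / n] tend
    to [M + t]. The step is odd so that the sample points can be numbered from [- h] to [h]. *)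
Let n (h : nat) : nat := (2 * h).+1.
Let v (h : nat) : R := (n h)%:R^-1.
Let m (h : nat) : nat := Num.truncn ((n h)%:R ^+ 2 / A).
Let mu (h : nat) : R := (m h)%:R * v h ^+ 2.
Let r (t : R) (h : nat) : int := Num.floor ((n h)%:R * t).
Let tau (t : R) (h : nat) : R := (r t h)%:~R * v h.

Let n_gt0 h : (0 : R) < (n h)%:R. Proof. by rewrite ltr0n. Qed.

Let v_gt0 h : 0 < v h. Proof. by rewrite invr_gt0. Qed.

Let nv h : (n h)%:R * v h = 1. Proof. by rewrite divff// gt_eqF. Qed.

Let v_le1 h : v h <= 1. Proof. by rewrite invf_le1// ler1n. Qed.

Let cvg_v : v @ \oo --> (0 : R).
Proof.
apply: (@squeeze_cvgr _ _ _ _ (cst 0) (@harmonic R)); last 2 first.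
- exact: cvg_cst.
- exact: cvg_harmonic.
near=> h; rewrite (ltW (v_gt0 h))/= lef_pV2 ?posrE ?ltr0n// ler_nat /n; lia.
Unshelve. all: by end_near. Qed.

Let muE h : A^-1 - v h ^+ 2 <= mu h <= A^-1.
Proof.
have nA : 0 <= (n h)%:R ^+ 2 / A by rewrite divr_ge0 ?sqr_ge0// ltW.
have /andP[m1 m2] := truncn_itv nA.
have An : A^-1 = (n h)%:R ^+ 2 / A * v h ^+ 2.
  by rewrite mulrAC -exprMn nv expr1n mul1r.
apply/andP; split.
  rewrite {1}An lerBlDr -[X in _ + X]mul1r -mulrDl ler_wpM2r ?sqr_ge0//.
  by rewrite natr1 ltW.
by rewrite An ler_wpM2r ?sqr_ge0.
Qed.

Let cvg_mu : mu @ \oo --> A^-1.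
Proof.
apply: (@squeeze_cvgr _ _ _ _ (fun h => A^-1 - v h ^+ 2) (cst A^-1)).
- by near=> h; exact: muE.
- rewrite -[X in _ --> X]subr0; apply: cvgB; first exact: cvg_cst.
  have -> : (0 : R) = 0 * 0 by rewrite mulr0.
  by under eq_fun do rewrite expr2; exact: cvgM.
- exact: cvg_cst.
Unshelve. all: by end_near. Qed.

Let tauE t h : t - v h <= tau t h <= t.
Proof.
have /andP[r1 r2] := floor_itv ((n h)%:R * t).
have tn : t = (n h)%:R * t * v h by rewrite mulrAC nv mul1r.
apply/andP; split.
  rewrite {1}tn lerBlDr -[X in _ + X]mul1r -mulrDl ler_wpM2r ?(ltW (v_gt0 h))//.
  by rewrite ltW// (lt_le_trans r2)// rmorphD.
by rewrite {2}tn ler_wpM2r ?(ltW (v_gt0 h)).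
Qed.

Let cvg_tau t : tau t @ \oo --> t.
Proof.
apply: (@squeeze_cvgr _ _ _ _ (fun h => t - v h) (cst t)).
- by near=> h; exact: tauE.
- by rewrite -[X in _ --> X]subr0; apply: cvgB => //; exact: cvg_cst.
- exact: cvg_cst.
Unshelve. all: by end_near. Qed.

Let m_ge (h : nat) : 2 * A <= h%:R -> (2 * A)^-1 <= mu h.
Proof.
move=> hA; have /andP[h1 _] := muE h; apply: le_trans h1.
have A2 : 0 < 2 * A by rewrite mulr_gt0.
have -> : A^-1 = (2 * A)^-1 + (2 * A)^-1 by field; rewrite gt_eqF.
rewrite -addrA lerDl subr_ge0 (@le_trans _ _ (v h))//.
  by rewrite expr2 ger_pMl// v_le1.
rewrite lef_pV2 ?posrE// (le_trans hA)// ler_nat /n; lia.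
Qed.

(** Keeps [mu] away from 0: this makes the majorant of the cosines independent of [h] and excludes
    [m h = 0] on the binomial side. *)
Let near_m : exists N, forall h, (N <= h)%N -> (2 * A)^-1 <= mu h.
Proof.
exists (Num.truncn (2 * A)).+1 => h Nh; apply: m_ge.
have A2 : 0 <= 2 * A by rewrite mulr_ge0// ltW.
have /andP[_ /ltW h2] := truncn_itv A2.
by rewrite (le_trans h2)// ler_nat.
Qed.

(** [F] and [G] are the terms of the two sides of the rescaled Polya identity, [F0] and [G0] their
    limits. *)
Let F t y h (M : int) : R[i] :=
  (binom_ratio R (m h) `|((n h)%:Z * M + r t h)%R|%N)%:C * expi (2 * pi * (- y * M%:~R)).

Let F0 t y (M : int) : R[i] :=
  (expR (- A * (M%:~R + t) ^+ 2))%:C * expi (2 * pi * (- y * M%:~R)).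

(** Numbering the samples by [|q| <= h] puts the argument of the cosine in [[- pi / 2, pi / 2]] when
    [|y| <= 1 / 2], as [cos_sqr_le] requires. *)
Let G t y h (q : int) : R[i] :=
  if (`|q| <= h)%N then
    (cos (pi * ((q%:~R + y) * v h)) ^+ (2 * m h))%:C *
    expi (2 * pi * ((q%:~R + y) * tau t h))
  else 0.

Let G0 t y (q : int) : R[i] :=
  (expR (- (pi ^+ 2 / A) * (q%:~R + y) ^+ 2))%:C *
  expi (2 * pi * ((q%:~R + y) * t)).

Let absE t h M : (`|((n h)%:Z * M + r t h)%R|%N%:R : R) * v h = `|M%:~R + tau t h|.
Proof.
rewrite natr_absz intr_norm rmorphD rmorphM/= -pmulrn.
rewrite -[X in _ * X](gtr0_norm (v_gt0 h)) -normrM mulrDl mulrAC nv mul1r//.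
Qed.

(** For [k <= m] the denominator [m + k] is at most [2 m <= 2 n ^ 2 / A], whence the halved
    exponent; for [k > m] the ratio is 0. *)
Let binom_ratio_gauss t h M : 0 < mu h ->
  binom_ratio R (m h) `|((n h)%:Z * M + r t h)%R|%N <=
  expR (- (A / 2) * (M%:~R + tau t h) ^+ 2).
Proof.
move=> mu0; set k := `|_|%N.
have m0 : (0 < m h)%N by move: mu0; rewrite /mu; case: (m h) => //; rewrite mul0r ltxx.
have [km|km] := leqP k (m h); last by rewrite binom_ratio_gt// expR_ge0.
rewrite (le_trans (binom_ratio_le _ _ _))// ler_expR mulNr lerN2.
have mk0 : (0 : R) < (m h)%:R + k%:R by rewrite -natrD ltr0n addn_gt0 m0.
rewrite ler_pdivlMr//.
have kE : (M%:~R + tau t h) ^+ 2 = (k%:R * v h) ^+ 2 by rewrite absE real_normK ?num_real.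
rewrite kE exprMn.
have -> : A / 2 * (k%:R ^+ 2 * v h ^+ 2) * ((m h)%:R + k%:R) =
  k%:R ^+ 2 * (A / 2 * (((m h)%:R + k%:R) * v h ^+ 2)) by ring.
rewrite -[leRHS]mulr1 ler_wpM2l ?sqr_ge0//.
apply: (@le_trans _ _ (A / 2 * (2 * mu h))).
  rewrite ler_wpM2l ?divr_ge0 ?(ltW A0)// /mu mulrA ler_wpM2r ?sqr_ge0//.
  by rewrite mulr_natl mulr2n lerD2l ler_nat.
have /andP[_ h2] := muE h.
have -> : A / 2 * (2 * mu h) = A * mu h by field.
by rewrite -[leRHS](@divff _ A) ?gt_eqF// ler_wpM2l// ltW.
Qed.

Let domF t y : exists N, forall h, (N <= h)%N -> forall M,
  `|F t y h M| <= (expR (A / 2 * (`|t| + 1) ^+ 2) * expR (- (A / 2) / 2) ^+ `|M|%N)%:C.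
Proof.
have [N hN] := near_m; exists N => h /hN mu1 M.
have mu0 : 0 < mu h by rewrite (lt_le_trans _ mu1)// invr_gt0 mulr_gt0.
have A2 : 0 <= A / 2 by rewrite divr_ge0// ltW.
rewrite normrM norm_expi mulr1 normC_real lecR ger0_norm ?binom_ratio_ge0//.
rewrite (le_trans (binom_ratio_gauss _ _ mu0))//.
rewrite (le_trans (gauss_le_geometric _ _ A2))//.
rewrite ler_wpM2r ?exprn_ge0 ?expR_ge0// ler_expR ler_wpM2l//.
rewrite -(real_normK (num_real (tau t h))) lerXn2r ?nnegrE ?addr_ge0//.
have /andP[h1 h2] := tauE t h; have vv := v_le1 h.
have v0 := v_gt0 h.
have -> : tau t h = t - (t - tau t h) by ring.
rewrite (le_trans (ler_normB _ _))// lerD2l ger0_norm; lra.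
Qed.

Let domF0 t y M :
  `|F0 t y M| <= (expR (A / 2 * (`|t| + 1) ^+ 2) * expR (- (A / 2) / 2) ^+ `|M|%N)%:C.
Proof.
have A2 : 0 <= A / 2 by rewrite divr_ge0// ltW.
rewrite normrM norm_expi mulr1 normC_real lecR ger0_norm ?expR_ge0//.
(* Weakened to [A / 2] so that the limit shares the majorant of [F]. *)
apply: (@le_trans _ _ (expR (- (A / 2) * (M%:~R + t) ^+ 2))).
  rewrite ler_expR ler_wpM2r ?sqr_ge0// lerN2; move: A0; lra.
rewrite (le_trans (gauss_le_geometric _ _ A2))//.
rewrite ler_wpM2r ?exprn_ge0 ?expR_ge0// ler_expR ler_wpM2l//.
rewrite -(real_normK (num_real t)) lerXn2r ?nnegrE ?addr_ge0//; lra.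
Qed.

(** Squeeze between the two bounds on [binom_ratio]. With [x = |M + tau|], their exponents
    [k ^ 2 / (m + k)] and [k ^ 2 / (m + 1 - k)] become [x ^ 2] over [mu] plus terms in [x v] and
    [v ^ 2], which tend to 0. *)
Let limF t y M : seq_lim (fun h => F t y h M) (F0 t y M).
Proof.
apply: seq_limM; last exact: seq_lim_cst.
apply: seq_lim_real_complex; apply: seq_lim_cvg.
pose k h := `|((n h)%:Z * M + r t h)%R|%N.
pose x h := `|M%:~R + tau t h|.
have kv h : (k h)%:R * v h = x h by exact: absE.
have cx : x @ \oo --> `|M%:~R + t|.
  by apply: cvg_norm; apply: cvgD; [exact: cvg_cst|exact: cvg_tau].
have cxv : (fun h => x h * v h) @ \oo --> (0 : R).
  by rewrite -[X in _ --> X](mulr0 `|M%:~R + t|); exact: cvgM.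
have cv2 : (fun h => v h * v h) @ \oo --> (0 : R).
  by rewrite -[X in _ --> X](mulr0 (0 : R)); exact: cvgM.
have lim_exp (d : nat -> R) : d @ \oo --> A^-1 ->
    (fun h => expR (- (x h * x h / d h))) @ \oo --> expR (- A * (M%:~R + t) ^+ 2).
  move=> dA; apply: continuous_cvg; first exact: continuous_expR.
  have -> : - A * (M%:~R + t) ^+ 2 = - (`|M%:~R + t| * `|M%:~R + t| / A^-1).
    by rewrite -expr2 real_normK ?num_real// invrK mulNr mulrC.
  apply: cvgN; apply: cvgM; first exact: cvgM.
  by apply: cvgV => //; rewrite invr_neq0// gt_eqF.
apply: (@squeeze_cvgr _ _ _ _ (fun h => expR (- (x h * x h / (mu h + v h * v h - x h * v h))))
   (fun h => expR (- (x h * x h / (mu h + x h * v h))))); last 2 first.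
- apply: lim_exp; rewrite -[A^-1]subr0 -[X in X - 0]addr0.
  by apply: cvgB => //; exact: cvgD.
- by apply: lim_exp; rewrite -[A^-1]addr0; exact: cvgD.
have cm : (fun h => mu h - x h * v h) @ \oo --> A^-1.
  by rewrite -[A^-1]subr0; exact: cvgB.
near=> h.
have km : 0 < mu h - x h * v h.
  by near: h; apply: (cvgr_gt _ cm); rewrite invr_gt0.
have v2 : 0 < v h ^+ 2 by rewrite exprn_gt0.
have xvE : x h * v h = (k h)%:R * v h ^+ 2 by rewrite -kv -mulrA -expr2.
have {km} km : (k h < m h)%N.
  by move: km; rewrite xvE /mu -mulrBl pmulr_lgt0// subr_gt0 ltr_nat.
have m0 : (0 < m h)%N by lia.
have xxE : x h * x h = (k h)%:R ^+ 2 * v h ^+ 2 by rewrite -kv -expr2 exprMn.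
rewrite xvE xxE /mu; apply/andP; split.
  apply: le_trans (binom_ratio_ge R (ltnW km)).
  rewrite le_eqVlt; apply/orP; left; apply/eqP; congr expR.
  have -> : (m h)%:R * v h ^+ 2 + v h * v h - (k h)%:R * v h ^+ 2 =
    ((m h)%:R + 1 - (k h)%:R) * v h ^+ 2 by ring.
  by rewrite -mulf_div divff ?mulr1// gt_eqF.
apply: (le_trans (binom_ratio_le R (ltnW km) m0)).
rewrite le_eqVlt; apply/orP; left; apply/eqP; congr expR.
by rewrite -mulrDl -mulf_div divff ?mulr1// gt_eqF.
Unshelve. all: by end_near. Qed.

(** [cos_sqr_le] raised to the power [m]; the constant [8 A] combines its [1 / 4] with
    [mu >= 1 / (2 A)]. *)
Let domG t y : `|y| <= 1 / 2 -> exists N, forall h, (N <= h)%N -> forall q,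
  `|G t y h q| <= (expR (- (pi ^+ 2 / (8 * A)) * (q%:~R + y) ^+ 2))%:C.
Proof.
move=> y2; have [N hN] := near_m; exists N => h /hN mu1 q.
rewrite /G; case: ifPn => [qh|_]; last by rewrite normr0 lecR expR_ge0.
rewrite normrM norm_expi mulr1 normC_real lecR exprM normrX ger0_norm ?sqr_ge0//.
have pi0 := pi_gt0 R.
apply: (@le_trans _ _ (expR (- ((pi * ((q%:~R + y) * v h)) ^+ 2 / 4)) ^+ m h)).
  rewrite lerXn2r ?nnegrE ?sqr_ge0 ?expR_ge0// cos_sqr_le//.
  rewrite !normrM (gtr0_norm pi0) (gtr0_norm (v_gt0 h)) ler_wpM2l ?(ltW pi0)//.
  have qy : `|q%:~R + y| <= (n h)%:R / 2.
    have : `|q%:~R + y| <= h%:R + 1 / 2.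
      by rewrite (le_trans (ler_normD _ _))// lerD// -intr_norm -natr_absz ler_nat.
    have -> : (n h)%:R = 2 * h%:R + 1 :> R by rewrite -natrM natr1.
    lra.
  by rewrite (le_trans (ler_wpM2r (ltW (v_gt0 h)) qy))// mulrAC nv mul1r.
rewrite -expRM_natl ler_expR.
have -> : (m h)%:R * - ((pi * ((q%:~R + y) * v h)) ^+ 2 / 4) =
   - (mu h * (pi ^+ 2 * (q%:~R + y) ^+ 2 / 4)) by rewrite /mu; ring.
have -> : - (pi ^+ 2 / (8 * A)) * (q%:~R + y) ^+ 2 =
   - ((2 * A)^-1 * (pi ^+ 2 * (q%:~R + y) ^+ 2 / 4)) by field; rewrite gt_eqF.
by rewrite lerN2 ler_wpM2r// divr_ge0// mulr_ge0// sqr_ge0.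
Qed.

Let domG0 t y q :
  `|G0 t y q| <= (expR (- (pi ^+ 2 / (8 * A)) * (q%:~R + y) ^+ 2))%:C.
Proof.
rewrite normrM norm_expi mulr1 normC_real lecR ger0_norm ?expR_ge0//.
rewrite ler_expR ler_wpM2r ?sqr_ge0// lerN2 ler_wpM2l ?sqr_ge0//.
by rewrite lef_pV2 ?posrE ?mulr_gt0//; move: A0; lra.
Qed.

(** An even power of the cosine is [(1 - sin ^ 2) ^ m], and [m sin ^ 2 = mu (sin (pi x v) / v) ^ 2]
    tends to [(pi x) ^ 2 / A], as [cvg_1BX] requires. *)
Let limG t y q : seq_lim (fun h => G t y h q) (G0 t y q).
Proof.
pose x := q%:~R + y.
apply: (@eq_seq_lim _ (fun h => (cos (pi * x * v h) ^+ (2 * m h))%:C *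
    expi (2 * pi * (x * tau t h)))).
  (* From [h = |q|] on, the cutoff in [G] is inactive. *)
  by exists `|q|%N => h qh; rewrite /G qh -/x (mulrA pi x).
apply: seq_limM; last first.
  apply: seq_lim_expi; apply: cvgM; first exact: cvg_cst.
  by apply: cvgM; [exact: cvg_cst|exact: cvg_tau].
apply: seq_lim_real_complex; apply: seq_lim_cvg.
under eq_fun do rewrite exprM cos2sin2.
have -> : - (pi ^+ 2 / A) * x ^+ 2 = - (A^-1 * ((pi * x) * (pi * x))) by ring.
have sinv := @cvg_sin_div R v (pi * x) (fun h => @lt0r_neq0 R _ (v_gt0 h)) cvg_v.
apply: cvg_1BX => [h||]; first exact: sqr_ge0.
  have sin0 : (fun h => sin (pi * x * v h)) @ \oo --> (0 : R).
    rewrite -[X in _ --> X](@sin0 R); apply: continuous_cvg; first exact: continuous_sin.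
    by rewrite -[X in _ --> X](mulr0 (pi * x)); apply: cvgM; first exact: cvg_cst.
  by rewrite -[X in _ --> X](mulr0 (0 : R)); under eq_fun do rewrite expr2; exact: cvgM.
rewrite (_ : (fun h => _) = (fun h => mu h *
  (((v h)^-1 * sin (pi * x * v h)) * ((v h)^-1 * sin (pi * x * v h))))); last first.
  by apply/funext => h; rewrite /mu; field; exact: lt0r_neq0.
by apply: cvgM => //; exact: cvgM.
Qed.

Let T t y h : R[i] := \sum_(q < n h)
  ((cos (pi * ((q%:R + (y - h%:R)) / (n h)%:R))) ^+ (2 * m h))%:C *
       expi (2 * pi * ((q%:R + (y - h%:R)) * ((r t h)%:~R / (n h)%:R))).

Let sumG t y h : has_usum (G t y h) (T t y h).
Proof.
pose phi (q : 'I_(n h)) : int := q%:Z - h%:Z.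
pose psi (k : int) : 'I_(n h) := inord `|(k + h%:Z)%R|%N.
apply: (@has_usum_push _ _ _ _ phi psi).
- move=> q; have := ltn_ord q => qn.
  by apply/val_inj; rewrite /psi /phi /= inordK; move: qn; rewrite /n; lia.
- move=> k; rewrite /G; case: ifPn => [kh _|]; last by rewrite eqxx.
  by rewrite /phi /psi inordK; lia.
rewrite /T; under eq_bigr => q _.
  have -> : ((cos (pi * ((q%:R + (y - h%:R)) / (n h)%:R))) ^+ (2 * m h))%:C *
       expi (2 * pi * ((q%:R + (y - h%:R)) * ((r t h)%:~R / (n h)%:R))) = (G t y h \o phi) q.
    rewrite /= /G ifT; last by have := ltn_ord q; rewrite /phi /n; lia.
    by rewrite /phi rmorphB/= -!pmulrn addrA [q%:R + _ - _]addrAC.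
  over.
exact: has_usum_finType.
Qed.

Let kappa h : R[i] := 2 ^+ (2 * m h) / ((n h)%:R * 'C(2 * m h, m h)%:R).

Let sumF t y h : has_usum (F t y h) (kappa h * T t y h).
Proof.
have n0 : ((n h)%:R : R[i]) != 0 by rewrite pnatr_eq0.
have C0 : ('C(2 * m h, m h)%:R : R[i]) != 0 by rewrite pnatr_eq0 -lt0n bin_gt0; lia.
have := polya_identity (m h) (r t h) (y - h%:R) (ltn0Sn (2 * h)).
move=> /(has_usumZ ((n h)%:R * 'C(2 * m h, m h)%:R)^-1).
have -> : ((n h)%:R * 'C(2 * m h, m h)%:R)^-1 *
  \sum_(q < n h) ((2 * cos (pi * ((q%:R + (y - h%:R)) / (n h)%:R))) ^+ (2 * m h))%:C *
       expi (2 * pi * ((q%:R + (y - h%:R)) * ((r t h)%:~R / (n h)%:R))) =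
  kappa h * T t y h.
  rewrite /kappa mulrC -mulrA [_^-1 * _]mulrC mulrA; congr (_ / _).
  rewrite mulr_sumr; apply: eq_bigr => q _.
  by rewrite exprMn rmorphM mulrA rmorphXn/= rmorph_nat.
apply: eq_has_usum => M.
rewrite /F /binom_ratio fmorph_div/= !rmorph_nat.
(* Polya's identity was used at [y - h]; the integer [h] only adds whole turns. *)
have -> : 2 * pi * (- (y - h%:R) * M%:~R) =
   2 * pi * ((h%:Z * M)%:~R + - y * M%:~R) :> R.
  by rewrite rmorphM/= -pmulrn; ring.
by rewrite expi_scale -/(n h); field; rewrite C0 n0.
Qed.

Let usumF t y : exists l, has_usum (F0 t y) l.
Proof.
apply: (dominated_usum (domF0 t y)).
apply: bounded_sumsZ; first exact: expR_ge0.
by apply: bounded_sums_geometric; rewrite mulNr expR_lt1N// !divr_gt0.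
Qed.

Let pA0 : 0 < pi ^+ 2 / (8 * A).
Proof. by rewrite divr_gt0 ?exprn_gt0 ?pi_gt0// mulr_gt0. Qed.

Let usumG t y : exists l, has_usum (G0 t y) l.
Proof. exact: dominated_usum (domG0 t y) (bounded_sums_gauss y pA0). Qed.

Let limT t y S : `|y| <= 1 / 2 -> has_usum (G0 t y) S -> seq_lim (T t y) S.
Proof.
move=> y2 GS; have [s hs] := bounded_sums_ex (bounded_sums_gauss y pA0).
exact: tannery (domG t y2) (domG0 t y) (has_usum_real_complex hs)
  (limG t y) (sumG t y) GS.
Qed.

Let limS t y S : has_usum (F0 t y) S -> seq_lim (fun h => kappa h * T t y h) S.
Proof.
move=> FS.
have bs : bounded_sums (fun M : int => expR (A / 2 * (`|t| + 1) ^+ 2) * expR (- (A / 2) / 2) ^+ `|M|%N).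
  apply: bounded_sumsZ; first exact: expR_ge0.
  by apply: bounded_sums_geometric; rewrite mulNr expR_lt1N// !divr_gt0.
have [s hs] := bounded_sums_ex bs.
exact: tannery (domF t y) (domF0 t y) (has_usum_real_complex hs)
  (limF t y) (sumF t y) FS.
Qed.

(** At [t = y = 0] the terms are positive and the one at [q = 0] is 1, so a partial sum that
    includes it is at least 1. *)
Let sumG00_neq0 S : has_usum (G0 0 0) S -> S != 0.
Proof.
move=> hS; apply/eqP => S0; have [B hB] := hS 1 ltr01.
have B0 : {subset B <= undup (0 :: B)}.
  by move=> x xB; rewrite mem_undup inE xB orbT.
have := hB _ (undup_uniq _) B0; rewrite S0 subr0.
pose g (q : int) : R := expR (- (pi ^+ 2 / A) * (q%:~R + 0) ^+ 2).
have -> : \sum_(q <- undup (0 :: B)) G0 0 0 q = (\sum_(q <- undup (0 :: B)) g q)%:C.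
  rewrite rmorph_sum; apply: eq_bigr => q _.
  by rewrite /G0 /g !mulr0 expi0 mulr1.
rewrite normC_real (ltcR _ 1) ger0_norm; last by apply: sumr_ge0 => q _; exact: expR_ge0.
apply/negP; rewrite -leNgt.
rewrite (bigD1_seq (0 : int)) ?undup_uniq ?mem_undup ?mem_head//=.
rewrite {1}/g mulr0z addr0 expr0n/= mulr0 expR0 lerDl.
by apply: sumr_ge0 => q _; exact: expR_ge0.
Qed.

Theorem poisson_gauss : exists c : R[i], forall t y : R, exists S,
  has_usum (fun M : int => (expR (- A * (M%:~R + t) ^+ 2))%:C *
     expi (2 * pi * (- y * M%:~R))) (c * S) /\
  has_usum (fun q : int => (expR (- (pi ^+ 2 / A) * (q%:~R + y) ^+ 2))%:C *
     expi (2 * pi * ((q%:~R + y) * t))) S.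
Proof.
have [L0 hL0] := usumF 0 0; have [S0 hS0] := usumG 0 0.
have S00 := sumG00_neq0 hS0.
(* The constant is read off at [t = y = 0]. *)
exists (L0 / S0) => t y.
(* Both sums are 1-periodic in [y], the second after reindexing [q]; [y0] lies in the range that
   [limT] covers. *)
pose k := Num.floor (y + 1 / 2); pose y0 := y - k%:~R.
have yE : y = k%:~R + y0 by rewrite /y0; ring.
have y02 : `|y0| <= 1 / 2.
  have /andP[k1 k2] := floor_itv (y + 1 / 2); rewrite rmorphD/= in k2.
  by rewrite ler_norml /y0; move: k1 k2; rewrite -/k; lra.
have [L hL] := usumF t y0; have [S hS] := usumG t y0.
exists S; split.
  have -> : L0 / S0 * S = L.
    apply: (mulIf S00); rewrite mulrAC divfK//.
    have h00 : `|0 : R| <= 1 / 2 by rewrite normr0 divr_ge0.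
    (* [L0 * S] and [L * S0] are limits of the same sequence [kappa * T 0 0 * T t y0]. *)
    apply: (@seq_lim_unique _ (fun h => kappa h * T 0 0 h * T t y0 h)).
      by apply: seq_limM; [exact: limS|exact: limT].
    have := seq_limM (limS hL) (limT h00 hS0).
    by apply: eq_seq_lim; exists 0%N => h _; ring.
  apply: eq_has_usum hL => M; rewrite /F0; congr (_ * _).
  have -> : 2 * pi * (- y * M%:~R) = 2 * pi * ((- k * M)%:~R + - y0 * M%:~R) :> R.
    by rewrite {1}yE rmorphM rmorphN/=; ring.
  by rewrite expi_scale.
have hK : cancel (fun q : int => q + k) (fun q : int => q - k) by move=> q; ring.
have hK' : cancel (fun q : int => q - k) (fun q : int => q + k) by move=> q; ring.
apply: eq_has_usum (has_usum_reindex hK hK' hS) => q.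
have E : (q + k)%:~R + y0 = q%:~R + y by rewrite rmorphD/= /y0; ring.
by rewrite /G0 /= E.
Qed.

End Poisson.

(** * Fourier transform of the Gaussian *)

Section GaussianIntegrals.
Variable R : realType.
Local Notation leb := (@lebesgue_measure R).
Local Open Scope classical_set_scope.

Definition gaussian (A x : R) : R := expR (- A * x ^+ 2).

Lemma continuous_affine (a b : R) : continuous (fun x : R => a * x + b).
Proof.
by move=> x; apply: cvgD; [apply: cvgM; [exact: cvg_cst|exact: cvg_id]|exact: cvg_cst].
Qed.

Lemma continuous_gaussian (A : R) : continuous (gaussian A).
Proof.
move=> x; apply: continuous_cvg; first exact: continuous_expR.
by apply: cvgM; [exact: cvg_cst|exact: exprn_continuous].
Qed.

Lemma continuous_cos_affine (a b : R) : continuous (fun x : R => cos (a * x + b)).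
Proof.
by move=> x; apply: (@continuous_comp _ _ _ (fun x => a * x + b) (@cos R)); [exact: continuous_affine|exact: continuous_cos].
Qed.

Lemma continuous_sin_affine (a b : R) : continuous (fun x : R => sin (a * x + b)).
Proof.
by move=> x; apply: (@continuous_comp _ _ _ (fun x => a * x + b) (@sin R)); [exact: continuous_affine|exact: continuous_sin].
Qed.

Lemma continuousMr (f g : R -> R) : continuous f -> continuous g ->
  continuous (fun x => f x * g x).
Proof. by move=> cf cg x; apply: cvgM; [exact: cf|exact: cg]. Qed.

(** A Gaussian is a multiple of the normal density of variance [1 / (2 A)]: this gives integrability
    and a non-zero integral without computing it. *)
Let gaussian_normal (A : R) (s := Num.sqrt (2 * A)^-1) : 0 < A ->
  s != 0 /\ forall x, normal_pdf 0 s x = normal_peak s * gaussian A x.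
Proof.
move=> A0; have A2 : 0 < (2 * A)^-1 by rewrite invr_gt0 mulr_gt0.
have s0 : s != 0 by rewrite gt_eqF// sqrtr_gt0.
split=> // x; rewrite normal_pdfE// /normal_fun /gaussian subr0 sqr_sqrtr ?(ltW A2)//.
by congr (_ * expR _); rewrite -mulr_natr; field; rewrite gt_eqF.
Qed.

Lemma integrable_gaussian (A : R) : 0 < A ->
  leb.-integrable setT (EFin \o gaussian A).
Proof.
move=> A0; have [s0 hs] := gaussian_normal A0.
have p0 := normal_peak_gt0 s0.
have := @integrableZl _ _ _ leb setT measurableT (normal_peak (Num.sqrt (2 * A)^-1))^-1
   _ (integrable_normal_pdf 0 (Num.sqrt (2 * A)^-1)).
apply: eq_integrable => //= x _.
by rewrite hs -EFinM mulKf// gt_eqF.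
Qed.

Lemma integral_gaussian_neq0 (A : R) : 0 < A -> \int[leb]_x gaussian A x != 0.
Proof.
move=> A0; have [s0 hs] := gaussian_normal A0.
have h1 : \int[leb]_x normal_pdf 0 (Num.sqrt (2 * A)^-1) x = 1.
  by rewrite /Rintegral integral_normal_pdf.
apply/eqP => h0; move: h1; rewrite (eq_Rintegral leb (fun x _ => hs x)).
by rewrite RintegralZl ?integrable_gaussian// h0 mulr0 => /eqP; rewrite eq_sym oner_eq0.
Qed.

Lemma integrable_gaussian_dominated (A K : R) (f : R -> R) : 0 < A ->
  continuous f -> (forall x, `|f x| <= K * gaussian A x) ->
  leb.-integrable setT (EFin \o f).
Proof.
move=> A0 cf fK.
have hK : leb.-integrable setT (EFin \o (fun x => K * gaussian A x)).
  have := @integrableZl _ _ _ leb setT measurableT K _ (integrable_gaussian A0).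
  by apply: eq_integrable.
apply: le_integrable hK => //.
  by apply/measurable_EFinP; exact: continuous_measurable_fun.
by move=> x _ /=; rewrite lee_fin (le_trans (fK x))// ler_norm.
Qed.

Let integral_shift (G : R -> R) (t : R) : continuous G -> (forall x, 0 <= G x) ->
  (\int[leb]_x (G x)%:E = \int[leb]_x (G (x + t))%:E)%E.
Proof.
move=> cG G0.
have dF x : is_derive x (1 : R) (fun x : R => x + t) 1.
  by apply: is_derive_eq; rewrite addr0.
have dF1 : (fun x : R => x + t)^`() = cst 1.
  by apply/funext => x; rewrite derive1E; exact: derive_val.
rewrite (@increasing_ge0_integration_by_substitutionT R (fun x => x + t) G) ?dF1//.
- by apply: eq_integral => x _ /=; rewrite mulr1.
- by move=> x y xy; rewrite ltrD2r.
- by move=> x; exact: cvg_cst.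
- by apply: is_cvg_cst.
- by apply: is_cvg_cst.
- exact: cvg_addrr_Ny.
- exact: cvg_addrr.
Qed.

Lemma continuous_shift (f : R -> R) t : continuous f -> continuous (fun x => f (x + t)).
Proof.
move=> cf x; apply: (@continuous_comp _ _ _ (fun x => x + t) f); last exact: cf.
by apply: cvgD; [exact: cvg_id|exact: cvg_cst].
Qed.

(** The substitution [integral_shift] is for nonnegative integrands: write [f = (f + g) - g] with
    the Gaussian majorant [g]. *)
Lemma Rintegral_shift (A K t : R) (f : R -> R) : 0 < A -> continuous f ->
  (forall x, `|f x| <= K * gaussian A x) ->
  \int[leb]_x f (x + t) = \int[leb]_x f x.
Proof.
move=> A0 cf fK.
pose g x := K * gaussian A x.
have K0 : 0 <= K.
  by have := le_trans (normr_ge0 _) (fK 0); rewrite pmulr_lge0// expR_gt0.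
have g0 x : 0 <= g x by rewrite mulr_ge0// expR_ge0.
have cg : continuous g by apply: continuousMr; [move=> x; exact: cvg_cst|exact: continuous_gaussian].
have fg0 x : 0 <= f x + g x by have := fK x; rewrite ler_norml -/(g x) => /andP[]; lra.
have cfg : continuous (fun x => f x + g x).
  by move=> x; apply: cvgD; [exact: cf|exact: cg].
have ig : leb.-integrable setT (EFin \o g).
  by apply: (@integrable_gaussian_dominated A K) => // x; rewrite ger0_norm.
have ifg : leb.-integrable setT (EFin \o (fun x => f x + g x)).
  apply: (@integrable_gaussian_dominated A (K + K)) => // x.
  by rewrite (le_trans (ler_normD _ _))// mulrDl lerD// ger0_norm.
have shifti (G : R -> R) : continuous G -> (forall x, 0 <= G x) ->
    leb.-integrable setT (EFin \o G) ->
    leb.-integrable setT (EFin \o (fun x => G (x + t))).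
  move=> cG G0 /integrableP[_ iG]; apply/integrableP; split.
    apply/measurable_EFinP; apply: continuous_measurable_fun.
    exact: continuous_shift.
  move: iG; under eq_integral do rewrite /= ger0_norm//.
  under [in X in _ -> X]eq_integral do rewrite /= ger0_norm//.
  by rewrite (integral_shift t cG G0).
have shiftR (G : R -> R) : continuous G -> (forall x, 0 <= G x) ->
    \int[leb]_x G (x + t) = \int[leb]_x G x.
  by move=> cG G0; rewrite /Rintegral -(integral_shift t cG G0).
have fE x : f x = (f x + g x) - g x by rewrite addrK.
rewrite (eq_Rintegral leb (fun x _ => fE (x + t))) [RHS](eq_Rintegral leb (fun x _ => fE x)).
have e1 := @RintegralB _ _ _ leb setT _ _ measurableT (shifti _ cfg fg0 ifg) (shifti _ cg g0 ig).
have e2 := @RintegralB _ _ _ leb setT _ _ measurableT ifg ig.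
have s1 := shiftR _ cfg fg0; have s2 := shiftR _ cg g0.
exact: (etrans e1 (etrans (f_equal2 (fun a b => a - b) s1 s2) (esym e2))).
Qed.

Lemma is_derive_Rintegral (A K a : R) (f df : R -> R -> R) : 0 < A ->
  (forall s x, is_derive s (1 : R) (f ^~ x) (df s x)) ->
  (forall s, leb.-integrable setT (EFin \o f s)) ->
  (forall s x, `|s - a| < 1 -> `|df s x| <= K * gaussian A x) ->
  is_derive a (1 : R) (fun s => \int[leb]_x f s x) (\int[leb]_x df a x).
Proof.
move=> A0 dfE fi dfK.
have K0 : 0 <= K.
  have := le_trans (normr_ge0 _) (dfK a 0 _); rewrite subrr normr0 => /(_ ltr01).
  by rewrite pmulr_lge0// expR_gt0.
have Ia : `]a - 1, a + 1[ a by rewrite /= in_itv/= ltrBlDr ltrDl ltr01.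
have iG : leb.-integrable setT (EFin \o (fun x => K * gaussian A x)).
  apply: (@integrable_gaussian_dominated A K) => //.
    by apply: continuousMr; [move=> x; exact: cvg_cst|exact: continuous_gaussian].
  by move=> x; rewrite ger0_norm// mulr_ge0// expR_ge0.
have partE s x : partial1of2 f s x = df s x.
  by rewrite partial1of2E; exact: derive_val.
have G0 x : 0 <= K * gaussian A x by rewrite mulr_ge0// expR_ge0.
have Gub s x : `]a - 1, a + 1[ s -> setT x -> `|partial1of2 f s x| <= K * gaussian A x.
  rewrite /= in_itv/= => sa _; rewrite partE dfK// ltr_norml; lra.
have der s x : `]a - 1, a + 1[ s -> setT x -> derivable (f ^~ x) s 1.
  by move=> _ _; exact: ex_derive.
apply: DeriveDef.
  exact: (derivable_under_integral measurableT Ia (fun s _ => fi s) der G0 iG Gub).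
rewrite -derive1E (differentiation_under_integral measurableT Ia (fun s _ => fi s) der G0 iG Gub).
by apply: eq_Rintegral => x _; rewrite partE.
Qed.

End GaussianIntegrals.

Section GaussianFourier.
Variables (R : realType) (A : R).
Hypothesis A0 : 0 < A.
Local Notation leb := (@lebesgue_measure R).
Local Open Scope classical_set_scope.

Let is_derive_affine (a b x : R) : is_derive x (1 : R) (fun x => a * x + b) a.
Proof.
have h : is_derive x (1 : R) (fun x : R => a * x) a.
  by have := @is_deriveZ _ _ _ id a x 1 1 (is_derive_id x 1); rewrite /GRing.scale/= mulr1.
by have := is_deriveD h (is_derive_cst b x 1); rewrite addr0.
Qed.

Let is_derive_gaussian (x : R) :
  is_derive x (1 : R) (gaussian A) (- 2 * A * x * gaussian A x).
Proof.
have h : is_derive x (1 : R) (fun x : R => - A * x ^+ 2) (- 2 * A * x).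
  have := @is_deriveZ _ _ _ _ (- A) x 1 _ (is_deriveX 2 (is_derive_id x (1 : R))).
  rewrite /GRing.scale/= => h; apply: (is_derive_eq h).
  by rewrite expr1 mulr1 -mulr_natr; ring.
have := @is_derive1_comp _ expR _ x _ _ (is_derive_expR _) h.
by move=> H; apply: (is_derive_eq H); rewrite mulrC.
Qed.

Let is_derive_cos_affine (a b x : R) :
  is_derive x (1 : R) (fun x => cos (a * x + b)) (- (a * sin (a * x + b))).
Proof.
have H := @is_derive1_comp _ cos _ x _ _ (is_derive_cos _) (is_derive_affine a b x).
by apply: (is_derive_eq H); rewrite mulNr mulrC.
Qed.

Let is_derive_sin_affine (a b x : R) :
  is_derive x (1 : R) (fun x => sin (a * x + b)) (a * cos (a * x + b)).
Proof.
have H := @is_derive1_comp _ sin _ x _ _ (is_derive_sin _) (is_derive_affine a b x).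
by apply: (is_derive_eq H); rewrite mulrC.
Qed.

(** Half of the exponent absorbs [|x|]: [|x| <= 1 + x ^ 2], and [expR u >= 1 + u] at
    [u = A x ^ 2 / 2]. *)
Let norm_mul_gaussian (x : R) :
  `|x| * gaussian A x <= (1 + 2 / A) * gaussian (A / 2) x.
Proof.
have -> : gaussian A x = gaussian (A / 2) x * gaussian (A / 2) x.
  by rewrite /gaussian -expRD; congr expR; field.
rewrite mulrA ler_wpM2r ?expR_ge0//.
have h1 : `|x| <= 1 + x ^+ 2.
  by rewrite -(real_normK (num_real x)); have := sqr_ge0 (`|x| - 1); have := normr_ge0 x; nra.
have h2 : 1 + x ^+ 2 <= (1 + 2 / A) * expR (A / 2 * x ^+ 2).
  have h3 := expR_ge1Dx (A / 2 * x ^+ 2).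
  apply: (@le_trans _ _ ((1 + 2 / A) * (1 + A / 2 * x ^+ 2))).
    have -> : (1 + 2 / A) * (1 + A / 2 * x ^+ 2) = 1 + x ^+ 2 + (2 / A + A / 2 * x ^+ 2).
      by field; rewrite gt_eqF.
    rewrite lerDl addr_ge0//; first by rewrite divr_ge0// ltW.
    by apply: mulr_ge0; [rewrite divr_ge0// ltW|exact: sqr_ge0].
  by rewrite ler_wpM2l// addr_ge0 ?divr_ge0// ltW.
have h := le_trans h1 h2.
rewrite (le_trans (ler_wpM2r (expR_ge0 _) h))// /gaussian -[leLHS]mulrA -expRD.
by rewrite mulNr subrr expR0 mulr1.
Qed.

(** Half of the exponent is given up to make the majorant uniform in the shift [t]. *)
Let gaussian_shift_le (B x t : R) : 0 <= B -> `|t| <= 1 ->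
  gaussian B (x + t) <= expR B * gaussian (B / 2) x.
Proof.
move=> B0 t1; rewrite /gaussian -expRD ler_expR.
have t2 : t ^+ 2 <= 1 by rewrite -(real_normK (num_real t)) expr_le1.
have -> : - B * (x + t) ^+ 2 = B * t ^+ 2 - B / 2 * x ^+ 2 - B / 2 * (x + 2 * t) ^+ 2.
  by field.
rewrite mulNr lerBlDr -[leLHS]addr0 lerD//; last by rewrite mulr_ge0 ?divr_ge0 ?sqr_ge0.
by rewrite lerD2r -[leRHS]mulr1 ler_wpM2l.
Qed.

Let wave (w p x : R) := gaussian A x * sin (w * x + p).
Let dwave (w p x : R) :=
  - 2 * A * x * gaussian A x * sin (w * x + p) + gaussian A x * (w * cos (w * x + p)).

Let is_derive_wave w p x : is_derive x (1 : R) (wave w p) (dwave w p x).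
Proof.
have H := is_deriveM (is_derive_gaussian x) (is_derive_sin_affine w p x).
apply: (is_derive_eq H).
by rewrite /GRing.scale/= /dwave addrC; congr (_ + _); rewrite mulrC.
Qed.

Let dwave_le w p x :
  `|dwave w p x| <= (2 * A * (1 + 2 / A) + `|w|) * gaussian (A / 2) x.
Proof.
rewrite (le_trans (ler_normD _ _))// mulrDl lerD//.
  rewrite normrM -[leRHS]mulr1 ler_pM// ?sin_max//.
  rewrite -!mulrA normrM normrN (ger0_norm (ler0n _ 2)) ler_wpM2l// normrM gtr0_norm//.
  rewrite ler_wpM2l ?(ltW A0)// normrM (ger0_norm (expR_ge0 _)).
  exact: norm_mul_gaussian.
rewrite normrM (ger0_norm (expR_ge0 _)) mulrC normrM.
rewrite ler_pM ?mulr_ge0 ?expR_ge0//; first by rewrite -[leRHS]mulr1 ler_wpM2l// cos_max.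
rewrite ler_expR ler_wpM2r ?sqr_ge0//; move: A0; lra.
Qed.

Let A2 : 0 < A / 2. Proof. by rewrite divr_gt0. Qed.
Let A4 : 0 < A / 2 / 2. Proof. by rewrite divr_gt0. Qed.

Let wave_le w p x : `|wave w p x| <= 1 * gaussian A x.
Proof.
rewrite normrM (ger0_norm (expR_ge0 _)) mulrC ler_wpM2r ?expR_ge0//.
exact: sin_max.
Qed.

Let continuous_wave w p : continuous (wave w p).
Proof.
by apply: continuousMr; [exact: continuous_gaussian|exact: continuous_sin_affine].
Qed.

Let wave_shift_le w p s x : `|s| < 1 ->
  `|dwave w p (x + s)| <=
  ((2 * A * (1 + 2 / A) + `|w|) * expR (A / 2)) * gaussian (A / 2 / 2) x.
Proof.
move=> s1; rewrite (le_trans (dwave_le _ _ _))// -[leRHS]mulrA ler_wpM2l//.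
  by rewrite addr_ge0// !mulr_ge0// ?addr_ge0 ?divr_ge0// ltW.
by rewrite gaussian_shift_le// ltW.
Qed.

(* The integral of wave (x + s) does not depend on s. *)
Let integral_dwave w p : \int[leb]_x dwave w p x = 0.
Proof.
have h : is_derive (0 : R) (1 : R) (fun s => \int[leb]_x wave w p (x + s))
    (\int[leb]_x dwave w p (x + 0)).
  apply: (@is_derive_Rintegral _ _ _ 0 (fun s x => wave w p (x + s))
    (fun s x => dwave w p (x + s)) A4).
  - move=> s x; have hs : is_derive s (1 : R) (fun s : R => x + s) 1.
      by have := is_deriveD (is_derive_cst x s 1) (is_derive_id s (1 : R)); rewrite add0r.
    have H := @is_derive1_comp _ (wave w p) _ s _ _ (is_derive_wave w p (x + s)) hs.
    by apply: (is_derive_eq H); rewrite mulr1.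
  - move=> s; apply: (@integrable_gaussian_dominated _ (A / 2) (expR (A * s ^+ 2))) => //.
      by apply: continuous_shift; exact: continuous_wave.
    move=> x; rewrite (le_trans (wave_le _ _ _))// mul1r /gaussian -expRD ler_expR.
    have -> : A * s ^+ 2 + - (A / 2) * x ^+ 2 =
      - A * (x + s) ^+ 2 + A / 2 * (x + 2 * s) ^+ 2 by field.
    by rewrite lerDl mulr_ge0 ?sqr_ge0// ltW.
  - by move=> s x; rewrite subr0; exact: wave_shift_le.
have e : (fun s => \int[leb]_x wave w p (x + s)) = cst (\int[leb]_x wave w p x).
  by apply/funext => s; exact: Rintegral_shift A0 (@continuous_wave w p) (wave_le w p).
rewrite e in h; have := @derive_val _ _ _ _ _ _ _ h; rewrite derive_cst => /esym.
by under eq_Rintegral do rewrite addr0.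
Qed.

Let Phi (p w : R) := \int[leb]_x (gaussian A x * cos (w * x + p)).

(** Integration by parts: differentiating under the integral gives minus the integral of [x * wave],
    and [integral_dwave] relates this integral to [w * Phi]. *)
Let is_derive_Phi p w : is_derive w (1 : R) (Phi p) (- (w / (2 * A)) * Phi p w).
Proof.
have cw q x (f := fun w x : R => gaussian A x * cos (w * x + p)) :
    is_derive q (1 : R) (f ^~ x) (- (x * wave q p x)).
  have hs : is_derive q (1 : R) (fun q : R => cos (x * q + p)) (- (x * sin (x * q + p))).
    exact: is_derive_cos_affine.
  have := @is_deriveZ _ _ _ _ (gaussian A x) q 1 _ hs.
  rewrite /GRing.scale/= => H.
  have -> : f ^~ x = (gaussian A x \*: (fun q : R => cos (x * q + p))).
    by apply/funext => s; rewrite /f mulrC [s * x]mulrC mulrC.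
  by apply: (is_derive_eq H); rewrite /wave [q * x]mulrC; ring.
have cosle s x : `|gaussian A x * cos (s * x + p)| <= 1 * gaussian A x.
  by rewrite normrM (ger0_norm (expR_ge0 _)) mulrC ler_wpM2r ?expR_ge0// cos_max.
have ccos s : continuous (fun x : R => gaussian A x * cos (s * x + p)).
  by apply: continuousMr; [exact: continuous_gaussian|exact: continuous_cos_affine].
have icos s := integrable_gaussian_dominated A0 (ccos s) (cosle s).
have xwave_le s x : `|- (x * wave s p x)| <= (1 + 2 / A) * gaussian (A / 2) x.
  rewrite normrN normrM (le_trans _ (norm_mul_gaussian x))// ler_wpM2l//.
  by rewrite (le_trans (wave_le _ _ _))// mul1r.
have h := @is_derive_Rintegral _ _ _ w _ _ A2 cw icos (fun s x _ => xwave_le s x).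
apply: (is_derive_eq h).
have cxw : continuous (fun x : R => - (x * wave w p x)).
  move=> x; apply: cvgN; apply: cvgM; first exact: cvg_id.
  exact: continuous_wave.
have ixw := integrable_gaussian_dominated A2 cxw (xwave_le w).
have := integral_dwave w p.
have dE x : dwave w p x = 2 * A * (- (x * wave w p x)) + w * (gaussian A x * cos (w * x + p)).
  by rewrite /dwave /wave; ring.
rewrite (eq_Rintegral leb (fun x _ => dE x)) RintegralD ?RintegralZl//; last 2 first.
- exact: (@integrableZl _ _ _ leb setT measurableT (2 * A) _ ixw).
- exact: (@integrableZl _ _ _ leb setT measurableT w _ (icos w)).
move=> E; apply: (@mulfI _ (2 * A)); first by rewrite mulf_neq0// gt_eqF.
have {}E := addr0_eq E; rewrite -[LHS]opprK E.
by rewrite /Phi; field; rewrite gt_eqF.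
Qed.

(** By [is_derive_Phi], [Phi p w * expR (w ^ 2 / (4 A))] is constant in [w]; evaluate it at 0. *)
Lemma Rintegral_gaussian_cos (p w : R) :
  \int[leb]_x (gaussian A x * cos (w * x + p)) =
  (\int[leb]_x gaussian A x) * cos p * expR (- (w ^+ 2 / (4 * A))).
Proof.
pose g (w : R) := Phi p w * expR (w ^+ 2 / (4 * A)).
have g0 w' : is_derive w' (1 : R) g 0.
  have h : is_derive w' (1 : R) (fun x : R => (4 * A)^-1 * x ^+ 2) (w' / (2 * A)).
    have H := @is_deriveZ _ _ _ _ (4 * A)^-1 w' 1 _ (is_deriveX 2 (is_derive_id w' (1 : R))).
    apply: (is_derive_eq H); rewrite /GRing.scale/= expr1 mulr1.
    by field; rewrite gt_eqF.
  have H := is_deriveM (is_derive_Phi p w')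
    (@is_derive1_comp _ expR _ w' _ _ (is_derive_expR _) h).
  have -> : g = (Phi p : R -> R) * (expR \o (fun x : R => (4 * A)^-1 * x ^+ 2)).
    by apply/funext => s; rewrite /g /= mulrC [in RHS]mulrC [_ / _]mulrC.
  by apply: (is_derive_eq H); rewrite /GRing.scale/=; ring.
have := is_derive_0_is_cst w 0 g0.
rewrite /g expr0n/= mul0r expR0 mulr1.
have -> : Phi p 0 = (\int[leb]_x gaussian A x) * cos p.
  rewrite mulrC -RintegralZl ?integrable_gaussian//.
  by apply: eq_Rintegral => x _; rewrite mul0r add0r mulrC.
by move=> <-; rewrite -mulrA -expRD subrr expR0 mulr1.
Qed.

End GaussianFourier.

(** * Continuous Wigner function of a Gaussian *)

Section WignerGaussian.
Variable R : realType.
Local Notation leb := (@lebesgue_measure R).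

Definition qform (a b c x y : R) : R := a * x ^+ 2 + 2 * b * x * y + c * y ^+ 2.

Lemma Rintegral_shifted_wave (A K t w p : R) : 0 < A ->
  \int[leb]_x (K * gaussian A (x + t) * cos (w * x + p)) =
  K * (\int[leb]_x gaussian A x) * expR (- (w ^+ 2 / (4 * A))) * cos (p - w * t).
Proof.
move=> A0; pose f z := gaussian A z * cos (w * z + (p - w * t)).
have cf : continuous f.
  by apply: continuousMr; [exact: continuous_gaussian|exact: continuous_cos_affine].
have fle x : `|f x| <= 1 * gaussian A x.
  by rewrite normrM (ger0_norm (expR_ge0 _)) mulrC ler_wpM2r ?expR_ge0// cos_max.
have fE x : K * gaussian A (x + t) * cos (w * x + p) = K * f (x + t).
  by rewrite /f -mulrA; congr (_ * (_ * cos _)); ring.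
rewrite (eq_Rintegral leb (fun x _ => fE x)) RintegralZl//; last first.
  apply: (@integrable_gaussian_dominated _ (A / 2) (expR (A * t ^+ 2))).
  - by rewrite divr_gt0.
  - exact: continuous_shift.
  - move=> x; rewrite (le_trans (fle _))// mul1r /gaussian -expRD ler_expR.
    have -> : A * t ^+ 2 + - (A / 2) * x ^+ 2 =
      - A * (x + t) ^+ 2 + A / 2 * (x + 2 * t) ^+ 2 by field.
    by rewrite lerDl mulr_ge0 ?sqr_ge0// divr_ge0// ltW.
rewrite (Rintegral_shift t A0 cf fle) Rintegral_gaussian_cos//; ring.
Qed.

Lemma cintegral_shifted_wave (A K t w p : R) : 0 < A ->
  cintegral (fun x => (K * gaussian A (x + t))%:C * expi (w * x + p)) =
  (K * (\int[leb]_x gaussian A x) * expR (- (w ^+ 2 / (4 * A))))%:C * expi (p - w * t).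
Proof.
move=> A0; rewrite /cintegral.
have re x : complex.Re ((K * gaussian A (x + t))%:C * expi (w * x + p)) =
    K * gaussian A (x + t) * cos (w * x + p) by rewrite /= mul0r subr0.
(* The sine is the cosine with [p - pi / 2], so one real formula covers both parts. *)
have im x : complex.Im ((K * gaussian A (x + t))%:C * expi (w * x + p)) =
    K * gaussian A (x + t) * cos (w * x + (p - pi / 2)).
  by rewrite /= mul0r addr0 addrA cosBpihalf.
rewrite (eq_Rintegral leb (fun x _ => re x)) (eq_Rintegral leb (fun x _ => im x)).
rewrite !Rintegral_shifted_wave//.
have -> : p - pi / 2 - w * t = (p - w * t) - pi / 2 by ring.
by rewrite cosBpihalf /expi; simpc.
Qed.

Variables (sigma : 'M[R]_2).
Hypotheses (sigma_sym : sigma^T = sigma) (sigma_pos : posdef sigma).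
Let a := sigma 0 0.
Let b := sigma 0 1.
Let c := sigma 1 1.

Lemma row2_qform (x y : R) :
  ((\row_i [:: x; y]`_i : 'rV[R]_2) *m sigma *m (\row_i [:: x; y]`_i)^T) 0 0 =
  qform a b c x y.
Proof.
have sym : sigma 1 0 = sigma 0 1 by rewrite -{1}sigma_sym mxE.
rewrite !mxE !big_ord_recl big_ord0 !mxE !big_ord_recl !big_ord0 !mxE /=.
have -> : lift ord0 (ord0 : 'I_1) = 1 :> 'I_2 by apply/val_inj.
have -> : (ord0 : 'I_2) = 0 by apply/val_inj.
by rewrite sym /qform -/a -/b -/c; ring.
Qed.

Lemma posdef2 : 0 < a /\ 0 < a * c - b ^+ 2.
Proof.
have pos x y : (x != 0) || (y != 0) -> 0 < qform a b c x y.
  move=> xy; rewrite -row2_qform; apply: sigma_pos.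
  apply/negP => /eqP /rowP h; move: xy; have := h 0; have := h 1.
  by rewrite !mxE/= => -> ->; rewrite eqxx.
have a0 : 0 < a.
  by have := pos 1 0; rewrite oner_eq0/= /qform => /(_ isT); rewrite expr1n expr0n/=; lra.
(* At [(- b, a)] the form equals [a] times the determinant. *)
split=> //; have := pos (- b) a; rewrite (gt_eqF a0) orbT => /(_ isT).
have -> : qform a b c (- b) a = a * (a * c - b ^+ 2) by rewrite /qform; ring.
by rewrite pmulr_rgt0.
Qed.

Lemma gaussE (x y : R) : gauss sigma x y = expR (- (1 / 2) * qform a b c x y).
Proof. by rewrite /gauss row2_qform. Qed.

Lemma gauss_parallelogram (x y u v : R) :
  gauss sigma (x - u) (y - v) * gauss sigma (x + u) (y + v) =
  expR (- qform a b c x y) * expR (- qform a b c u v).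
Proof. by rewrite !gaussE -!expRD; congr expR; rewrite /qform; field. Qed.

(** Complete the square in [x1]: the inner integral is a Gaussian of parameter [a] shifted by
    [b / a * x2], the outer one has parameter [D / a] and a frequency altered by that shift.
    [qform c (- b) a / D] is the form of the inverse of [sigma]. The final constant divides by
    [w0]. *)
Lemma wigner_gauss : exists2 w0 : R, w0 != 0 & forall q1 q2 p1 p2 : R,
  wigner (fun x y => (gauss sigma x y)%:C) q1 q2 p1 p2 =
  (w0 * (expR (- qform a b c q1 q2) *
         expR (- (qform c (- b) a p1 p2 / (a * c - b ^+ 2)))))%:C.
Proof.
have [a0 D0] := posdef2; set D := a * c - b ^+ 2 in D0 *.
pose I1 := \int[leb]_x gaussian a x; pose I2 := \int[leb]_x gaussian (D / a) x.
have Da0 : 0 < D / a by rewrite divr_gt0.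
exists (1 / pi ^+ 2 * (I1 * I2)).
  rewrite !mulf_neq0 ?invr_eq0 ?integral_gaussian_neq0//.
  by rewrite expf_neq0// gt_eqF// pi_gt0.
move=> q1 q2 p1 p2; rewrite /wigner -[X in _ = X%:C]mulrA [RHS]rmorphM/=; congr (_ * _).
pose E := expR (- qform a b c q1 q2).
have inner x2 : cintegral (fun x1 => expi (- 2 * (p1 * x1 + p2 * x2)) *
    ((gauss sigma (q1 - x1) (q2 - x2))%:C)^* * (gauss sigma (q1 + x1) (q2 + x2))%:C) =
  (E * I1 * expR (- (p1 ^+ 2 / a)) * gaussian (D / a) (x2 + 0))%:C *
   expi ((2 * p1 * (b / a) - 2 * p2) * x2 + 0).
  have -> : (fun x1 => expi (- 2 * (p1 * x1 + p2 * x2)) *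
    ((gauss sigma (q1 - x1) (q2 - x2))%:C)^* * (gauss sigma (q1 + x1) (q2 + x2))%:C) =
    (fun x1 => (E * gaussian (D / a) x2 * gaussian a (x1 + b / a * x2))%:C *
      expi ((- 2 * p1) * x1 + (- 2 * p2 * x2))).
    apply/funext => x1.
    rewrite [X in _ * X * _](_ : _ = (gauss sigma (q1 - x1) (q2 - x2))%:C); last first.
      by rewrite geC0_conj// (lecR 0) expR_ge0.
    rewrite -mulrA -rmorphM/= gauss_parallelogram mulrC; congr (_%:C * expi _).
      rewrite -mulrA; congr (_ * _); rewrite /gaussian -expRD; congr expR.
      by rewrite /qform /D; field; rewrite gt_eqF.
    ring.
  rewrite cintegral_shifted_wave// !addr0; congr (_%:C * expi _).
    have -> : (- 2 * p1) ^+ 2 / (4 * a) = p1 ^+ 2 / a by field; rewrite gt_eqF.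
    by rewrite /I1; ring.
  ring.
rewrite (funext inner).
rewrite cintegral_shifted_wave// mulr0 subr0 expi0 mulr1; congr (_%:C).
rewrite -/I2 /E.
have -> : - (qform c (- b) a p1 p2 / D) = - (p1 ^+ 2 / a) +
    - ((2 * p1 * (b / a) - 2 * p2) ^+ 2 / (4 * (D / a))).
  by rewrite /qform /D; field; rewrite !gt_eqF.
by rewrite expRD; ring.
Qed.

End WignerGaussian.

(** * Poisson summation in two variables *)

Section Poisson2.
Variable R : realType.

(** Determinant over trace bounds the smallest eigenvalue from below: by Cayley-Hamilton, trace
    times form minus determinant times squared length is the squared length of the matrix applied to
    [(x, y)]. *)
Lemma qform_ge (a b c x y : R) : 0 < a -> 0 < a * c - b ^+ 2 ->
  0 < (a * c - b ^+ 2) / (a + c) /\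
  (a * c - b ^+ 2) / (a + c) * (x ^+ 2 + y ^+ 2) <= qform a b c x y.
Proof.
move=> a0 D0.
have c0 : 0 < c by rewrite -(pmulr_rgt0 _ a0); have := sqr_ge0 b; lra.
have ac : 0 < a + c by rewrite addr_gt0.
split; first by rewrite divr_gt0.
rewrite mulrAC ler_pdivrMr// -subr_ge0.
have -> : qform a b c x y * (a + c) - (a * c - b ^+ 2) * (x ^+ 2 + y ^+ 2) =
  (a * x + b * y) ^+ 2 + (b * x + c * y) ^+ 2 by rewrite /qform; ring.
by rewrite addr_ge0 ?sqr_ge0.
Qed.

Lemma bounded_sums_qform (a b c k t1 t2 : R) : 0 < a -> 0 < a * c - b ^+ 2 ->
  0 < k -> bounded_sums (fun M : int * int =>
    expR (- (k * qform a b c (M.1%:~R + t1) (M.2%:~R + t2)))).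
Proof.
move=> a0 D0 k0; have [l0 _] := qform_ge 0 0 a0 D0.
set l := _ / _ in l0.
have kl : 0 < k * l by rewrite mulr_gt0.
apply: bounded_sums_le (bounded_sumsM (bounded_sums_gauss t1 kl) (bounded_sums_gauss t2 kl)).
  by move=> M; exact: expR_ge0.
move=> M; rewrite -expRD ler_expR !mulNr -opprD lerN2 -mulrDr -mulrA ler_wpM2l ?(ltW k0)//.
by have [] := qform_ge (M.1%:~R + t1) (M.2%:~R + t2) a0 D0.
Qed.

Lemma norm_real_expi (x t : R) : 0 <= x -> `|x%:C * expi t| = x%:C.
Proof. by move=> x0; rewrite normrM norm_expi mulr1 normC_real ger0_norm. Qed.

(** [qform a b c u v = a (u + b v / a) ^ 2 + D v ^ 2 / a]. Poisson summation in the first variable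
    has a shift that depends on [M2]; the resulting phase, linear in [M2], displaces the frequency
    in the second variable. *)
Lemma poisson_gauss2 (a b c : R) : 0 < a -> 0 < a * c - b ^+ 2 ->
  exists k : R[i], forall t1 t2 y1 y2 : R, exists S,
  has_usum (fun M : int * int =>
     (expR (- qform a b c (M.1%:~R + t1) (M.2%:~R + t2)))%:C *
     expi (2 * pi * (- y1 * M.1%:~R - y2 * M.2%:~R))) (k * S) /\
  has_usum (fun q : int * int =>
     (expR (- (pi ^+ 2 / (a * c - b ^+ 2) * qform c (- b) a (q.1%:~R + y1) (q.2%:~R + y2))))%:C *
     expi (2 * pi * ((q.1%:~R + y1) * t1 + (q.2%:~R + y2) * t2))) S.
Proof.
move=> a0 D0; set D := a * c - b ^+ 2 in D0 *.
have c0 : 0 < c by rewrite -(pmulr_rgt0 _ a0); have := sqr_ge0 b; move: D0; rewrite /D; lra.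
have Da0 : 0 < D / a by rewrite divr_gt0.
have pi0 := pi_gt0 R; have pa0 : 0 < pi ^+ 2 / a by rewrite divr_gt0// exprn_gt0.
have [k1 hk1] := poisson_gauss a0; have [k2 hk2] := poisson_gauss Da0.
exists (k1 * k2) => t1 t2 y1 y2.
pose f (M : int * int) : R[i] := (expR (- qform a b c (M.1%:~R + t1) (M.2%:~R + t2)))%:C *
     expi (2 * pi * (- y1 * M.1%:~R - y2 * M.2%:~R)).
have [L hL] : exists L, has_usum f L.
  apply: (@dominated_usum _ _ f (fun M : int * int => expR (- (1 * qform a b c (M.1%:~R + t1) (M.2%:~R + t2))))).
    by move=> M; rewrite /f mul1r norm_real_expi ?expR_ge0.
  exact: bounded_sums_qform.
pose g (q : int * int) : R[i] :=
  (expR (- (pi ^+ 2 / D * qform c (- b) a (q.1%:~R + y1) (q.2%:~R + y2))))%:C *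
     expi (2 * pi * ((q.1%:~R + y1) * t1 + (q.2%:~R + y2) * t2)).
have D'0 : 0 < c * a - (- b) ^+ 2 by rewrite sqrrN mulrC.
have [S hS] : exists S, has_usum g S.
  apply: (@dominated_usum _ _ g (fun q : int * int =>
     expR (- (pi ^+ 2 / D * qform c (- b) a (q.1%:~R + y1) (q.2%:~R + y2))))).
    by move=> M; rewrite /g norm_real_expi ?expR_ge0.
  by apply: bounded_sums_qform => //; rewrite divr_gt0// exprn_gt0.
exists S; split; last exact: hS.
(* the mixed sum, over the frequency q1 and the position M2 *)
pose H (p : int * int) : R[i] :=
  (expR (- (pi ^+ 2 / a) * (p.1%:~R + y1) ^+ 2) * expR (- (D / a) * (p.2%:~R + t2) ^+ 2))%:C *
  expi (2 * pi * ((p.1%:~R + y1) * (t1 + b / a * (p.2%:~R + t2)) - y2 * p.2%:~R)).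
have [T hT] : exists T, has_usum H T.
  apply: (@dominated_usum _ _ H (fun p : int * int =>
    expR (- (pi ^+ 2 / a) * (p.1%:~R + y1) ^+ 2) * expR (- (D / a) * (p.2%:~R + t2) ^+ 2))).
    by move=> p; rewrite /H norm_real_expi// mulr_ge0 ?expR_ge0.
  exact: bounded_sumsM (bounded_sums_gauss y1 pa0) (bounded_sums_gauss t2 Da0).
(* First variable, at fixed [M2]. *)
have LT : L = k1 * T.
  have [S1 hS1] := choice (fun M2 : int => hk1 (t1 + b / a * (M2%:~R + t2)) y1).
  pose K (M2 : int) : R[i] := (expR (- (D / a) * (M2%:~R + t2) ^+ 2))%:C * expi (2 * pi * (- y2 * M2%:~R)).
  have h1 : has_usum (fun M2 => K M2 * (k1 * S1 M2)) L.
    apply: has_usum_snd hL _ => M2.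
    apply: eq_has_usum (has_usumZ (K M2) (hS1 M2).1) => M1.
    rewrite /f /K mulrACA -rmorphM/= -expRD -expiD; congr ((expR _)%:C * expi _).
      by rewrite /qform /D; field; rewrite gt_eqF.
    ring.
  have h2 : has_usum (fun M2 => K M2 * S1 M2) T.
    apply: has_usum_snd hT _ => M2.
    apply: eq_has_usum (has_usumZ (K M2) (hS1 M2).2) => q1.
    rewrite /H /K mulrACA -rmorphM/= mulrC [in RHS]mulrC -expiD; congr (expi _ * _%:C); ring.
  apply: has_usum_unique h1 _; apply: eq_has_usum (has_usumZ k1 h2) => M2; ring.
(* Second variable, at fixed [q1]. *)
have TS : T = k2 * S.
  have [S2 hS2] := choice (fun q1 : int => hk2 t2 (y2 - (q1%:~R + y1) * (b / a))).
  pose K (q1 : int) : R[i] := (expR (- (pi ^+ 2 / a) * (q1%:~R + y1) ^+ 2))%:C *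
    expi (2 * pi * ((q1%:~R + y1) * (t1 + b / a * t2))).
  have h1 : has_usum (fun q1 => K q1 * (k2 * S2 q1)) T.
    apply: has_usum_fst hT _ => q1.
    apply: eq_has_usum (has_usumZ (K q1) (hS2 q1).1) => M2.
    rewrite /H /K mulrACA -rmorphM/= -expiD; congr (_ * expi _); ring.
  have h2 : has_usum (fun q1 => K q1 * S2 q1) S.
    apply: has_usum_fst hS _ => q1.
    apply: eq_has_usum (has_usumZ (K q1) (hS2 q1).2) => q2.
    rewrite /g /K mulrACA -rmorphM/= -expRD -expiD; congr ((expR _)%:C * expi _).
      by rewrite /qform /D; field; rewrite !gt_eqF.
    ring.
  apply: has_usum_unique h1 _; apply: eq_has_usum (has_usumZ k2 h2) => M2; ring.
by rewrite -mulrA -TS -LT; exact: hL.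
Qed.

End Poisson2.

(** * Discrete Wigner function of a Gaussian *)

Section Residues.
Variable j : nat.
Local Notation d := (period j).

Lemma period_gt0 : (0 < d)%N. Proof. by rewrite /period; lia. Qed.

Lemma period_residue_subproof (M : int) : (`|((M + j%:Z) %% d)%Z|%N < d)%N.
Proof.
have d0 := period_gt0; rewrite -ltz_nat gez0_abs; first by rewrite ltz_pmod.
by rewrite modz_ge0// eqz_nat -lt0n.
Qed.

(** Adding [j] carries the representatives from [- j] to [j] to those from 0 to [d - 1]; the sign of
    the quotient follows the convention [M = m - al * d]. *)
Definition period_residue (M : int) : 'I_d := Ordinal (period_residue_subproof M).
Definition period_quotient (M : int) : int := - ((M + j%:Z) %/ d)%Z.
Definition unreduce (i : 'I_d) (al : int) : int := i%:Z - j%:Z - al * d%:Z.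

Lemma period_residueK (M : int) : unreduce (period_residue M) (period_quotient M) = M.
Proof.
have d0 := period_gt0.
rewrite /unreduce /period_residue /period_quotient /= gez0_abs; last first.
  by rewrite modz_ge0// eqz_nat -lt0n.
by have := divz_eq (M + j%:Z) d; lia.
Qed.

Let unreduceE i al : unreduce i al + j%:Z = (- al) * d%:Z + i%:Z.
Proof. by rewrite /unreduce; ring. Qed.

Lemma period_quotient_unreduce i al : period_quotient (unreduce i al) = al.
Proof.
have d0 : d%:Z != 0 by rewrite eqz_nat -lt0n period_gt0.
rewrite /period_quotient unreduceE divzMDl// divz_small ?addr0 ?opprK//.
by rewrite lez_nat ltz_nat /= ltn_ord.
Qed.

Lemma period_residue_unreduce i al : period_residue (unreduce i al) = i.
Proof.
apply/val_inj; rewrite /= unreduceE modzMDl modz_small//.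
by rewrite lez_nat ltz_nat /= ltn_ord.
Qed.

End Residues.

Section Discrete.
Variables (R : realType) (j : nat) (sigma : 'M[R]_2).
Hypotheses (sigma_sym : sigma^T = sigma) (sigma_pos : posdef sigma).
Local Notation a := (sigma 0 0).
Local Notation b := (sigma 0 1).
Local Notation c := (sigma 1 1).
Local Notation D := (a * c - b ^+ 2).
Local Notation d := (period j).
Local Notation s := (scale R j).

Let a0 : 0 < a. Proof. exact: (posdef2 sigma_sym sigma_pos).1. Qed.
Let D0 : 0 < D. Proof. exact: (posdef2 sigma_sym sigma_pos).2. Qed.
Let dR0 : (0 : R) < d%:R. Proof. by rewrite ltr0n period_gt0. Qed.

Let dN0 : (d%:R : R) != 0. Proof. exact: lt0r_neq0. Qed.

Let dN1 : (2 * j%:R + 1 : R) != 0.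
Proof. by have := dN0; rewrite /period natrD natrM. Qed.

Let c0 : 0 < c.
Proof. by rewrite -(pmulr_rgt0 _ a0); have := sqr_ge0 b; move: D0; lra. Qed.

Let s2 : s ^+ 2 = 2 * pi / d%:R.
Proof. by rewrite sqr_sqrtr// divr_ge0// mulr_ge0// pi_ge0. Qed.

Let s20 : 0 < s ^+ 2.
Proof. by rewrite s2 divr_gt0// mulr_gt0// pi_gt0. Qed.

Lemma expi_pi (z : int) : expi (pi * z%:~R : R) = (-1) ^ z.
Proof.
have h n : expi (pi * n%:R : R) = (-1) ^+ n.
  rewrite mulr_natr expiMn; congr (_ ^+ n).
  by rewrite /expi cospi sinpi; apply/eqP; rewrite eq_complex/= oppr0 !eqxx.
case: z => n; first exact: h.
rewrite NegzE -exprz_inv -exprnP invrN1 -h -[LHS]mulr1 -[RHS]mulr1.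
have -> : pi * (- n.+1%:Z)%:~R = pi * n.+1%:R + 2 * pi * (- n.+1%:Z)%:~R :> R.
  by rewrite rmorphN/= -pmulrn; ring.
by rewrite expiD expi_2piM mulr1.
Qed.

Definition lattice_gauss (n1 n2 : int) (al : int * int) : R :=
  gauss sigma ((n1 + al.1 * d%:Z)%:~R * s) ((n2 + al.2 * d%:Z)%:~R * s).

Lemma bounded_sums_lattice_gauss n1 n2 : bounded_sums (lattice_gauss n1 n2).
Proof.
have k0 : 0 < s ^+ 2 * d%:R ^+ 2 / 2 by rewrite divr_gt0// mulr_gt0// exprn_gt0.
apply: bounded_sums_le (bounded_sums_qform (n1%:~R / d%:R) (n2%:~R / d%:R) a0 D0 k0).
  by move=> al; rewrite /lattice_gauss gaussE// expR_ge0.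
move=> al; rewrite /lattice_gauss gaussE// le_eqVlt; apply/orP; left; apply/eqP.
congr expR; rewrite /qform !rmorphD !rmorphM/= -!pmulrn; by move: dN0; generalize (d%:R : R) => e e0; field.
Qed.

Lemma has_usum_dgauss n1 n2 : has_usum (lattice_gauss n1 n2) (dgauss j sigma n1 n2).
Proof.
have [l hl] := bounded_sums_ex (bounded_sums_lattice_gauss n1 n2).
suff -> : dgauss j sigma n1 n2 = l by [].
exact: (has_usum_sumZ2 hl).2.
Qed.

Variables n1 n2 k1 k2 : int.

Definition phase (M1 M2 : int) : R[i] := expi (- (4 * pi / d%:R) * (k1 * M1 + k2 * M2)%:~R).

(** The square of [gauss] at the point scaled by [s], which is why its [1 / 2] is gone. *)
Definition weight (x y : R) : R := expR (- (s ^+ 2 * qform a b c x y)).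

Definition half_shift (n al : int) : R := n%:~R + al%:~R * (d%:R / 2).

Definition doubled_term (p : (int * int) * (int * int)) : R[i] :=
  (weight (half_shift n1 p.1.1) (half_shift n2 p.1.2) * weight (half_shift p.2.1 p.1.1) (half_shift p.2.2 p.1.2))%:C *
  phase p.2.1 p.2.2.

Let W (m : 'I_d * 'I_d) (p : (int * int) * (int * int)) : R[i] :=
  let m1 := m.1%:Z - j%:Z in let m2 := m.2%:Z - j%:Z in
  phase m1 m2 * (lattice_gauss (n1 - m1) (n2 - m2) p.1 *
                 lattice_gauss (n1 + m1) (n2 + m2) p.2)%:C.

(** Change of variables from [(m, (alpha, beta))] to [(gamma, M)]. It is a bijection: [M] determines
    [m] and [alpha] by division by [d], and then [beta = gamma - alpha]. *)
Let h (p : ('I_d * 'I_d) * ((int * int) * (int * int))) :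
    (int * int) * (int * int) :=
  ((p.2.1.1 + p.2.2.1, p.2.1.2 + p.2.2.2),
   (unreduce p.1.1 p.2.1.1, unreduce p.1.2 p.2.1.2)).

Let h' (q : (int * int) * (int * int)) :
    ('I_d * 'I_d) * ((int * int) * (int * int)) :=
  ((period_residue j q.2.1, period_residue j q.2.2),
   ((period_quotient j q.2.1, period_quotient j q.2.2),
    (q.1.1 - period_quotient j q.2.1, q.1.2 - period_quotient j q.2.2))).

Let hK : cancel h h'.
Proof.
move=> [[m1 m2] [[al1 al2] [be1 be2]]].
rewrite /h /h' /= !period_quotient_unreduce !period_residue_unreduce.
by rewrite ![_ + _ - _]addrAC !subrr !add0r.
Qed.

Let h'K : cancel h' h.
Proof. by move=> [[g1 g2] [M1 M2]]; rewrite /h /h' /= !period_residueK ![_ + (_ - _)]addrC !subrK. Qed.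

Let TW p : doubled_term (h p) = W p.1 p.2.
Proof.
case: p => [[m1 m2] [[al1 al2] [be1 be2]]]; rewrite /doubled_term /W /h /= mulrC; congr (_ * _%:C).
  rewrite /phase /unreduce.
  (* Passing from [m] to [m - alpha d] adds [2 k.alpha] whole turns. *)
  have -> : - (4 * pi / d%:R) * (k1 * (m1%:Z - j%:Z - al1 * d%:Z) + k2 * (m2%:Z - j%:Z - al2 * d%:Z))%:~R =
    2 * pi * ((2 * (k1 * al1 + k2 * al2))%:~R +
      - (2 / d%:R) * (k1 * (m1%:Z - j%:Z) + k2 * (m2%:Z - j%:Z))%:~R) :> R.
    rewrite !(rmorphD, rmorphN, rmorphM)/= -!pmulrn; by move: dN0; generalize (d%:R : R) => e e0; field.
  by rewrite expi_scale; congr expi; move: dN0; generalize (d%:R : R) => e e0; field.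
pose x := half_shift n1 (al1 + be1) * s; pose y := half_shift n2 (al2 + be2) * s.
pose u := half_shift (unreduce m1 al1) (al1 + be1) * s.
pose v := half_shift (unreduce m2 al2) (al2 + be2) * s.
have := gauss_parallelogram sigma_sym x y u v.
have EQ x' y' : weight x' y' = expR (- qform a b c (x' * s) (y' * s)).
  by rewrite /weight; congr expR; rewrite /qform; ring.
have e1 (n al be : int) (m : 'I_d) :
    half_shift n (al + be) * s - half_shift (unreduce m al) (al + be) * s =
    ((n - (m%:Z - j%:Z)) + al * d%:Z)%:~R * s.
  rewrite /half_shift /unreduce !(rmorphD, rmorphN, rmorphM)/= -!pmulrn.
  by generalize (d%:R : R) => e; field.
have e2 (n al be : int) (m : 'I_d) :
    half_shift n (al + be) * s + half_shift (unreduce m al) (al + be) * s =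
    ((n + (m%:Z - j%:Z)) + be * d%:Z)%:~R * s.
  rewrite /half_shift /unreduce !(rmorphD, rmorphN, rmorphM)/= -!pmulrn.
  by generalize (d%:R : R) => e; field.
by rewrite !EQ => <-; rewrite /x /y /u /v !e1 !e2.
Qed.

Let boundedW : bounded_sums (fun p : ('I_d * 'I_d) * ((int * int) * (int * int)) =>
  let m1 := p.1.1%:Z - j%:Z in let m2 := p.1.2%:Z - j%:Z in
  lattice_gauss (n1 - m1) (n2 - m2) p.2.1 * lattice_gauss (n1 + m1) (n2 + m2) p.2.2).
Proof.
apply: (@bounded_sums_finM _ _ _ (fun (m : 'I_d * 'I_d) (p : (int * int) * (int * int)) =>
  lattice_gauss (n1 - (m.1%:Z - j%:Z)) (n2 - (m.2%:Z - j%:Z)) p.1 *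
  lattice_gauss (n1 + (m.1%:Z - j%:Z)) (n2 + (m.2%:Z - j%:Z)) p.2)) => m.
by apply: bounded_sumsM; exact: bounded_sums_lattice_gauss.
Qed.

(** Joint summability over [(m, alpha, beta)] comes first; Fubini over the finite index [m] recovers
    the sum of products in [dwigner], and [h'] reindexes. *)
Lemma has_usum_dwigner :
  has_usum doubled_term (d%:R ^+ 2 * dwigner j (fun m1 m2 => (dgauss j sigma m1 m2)%:C) n1 n2 k1 k2).
Proof.
have [l hl] : exists l, has_usum (fun p => W p.1 p.2) l.
  apply: dominated_usum boundedW => p.
  rewrite /W mulrC norm_real_expi// mulr_ge0 ?(bounded_sums_lattice_gauss _ _).1//.
have -> : d%:R ^+ 2 * dwigner j (fun m1 m2 => (dgauss j sigma m1 m2)%:C) n1 n2 k1 k2 = l.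
  have hm (m : 'I_d * 'I_d) (m1 := m.1%:Z - j%:Z) (m2 := m.2%:Z - j%:Z) :
      has_usum (W m) (phase m1 m2 * (dgauss j sigma (n1 - m1) (n2 - m2) *
                 dgauss j sigma (n1 + m1) (n2 + m2))%:C).
    rewrite /W -/m1 -/m2; apply: has_usumZ; apply: has_usum_real_complex.
    have bs := bounded_sumsM (bounded_sums_lattice_gauss (n1 - m1) (n2 - m2))
      (bounded_sums_lattice_gauss (n1 + m1) (n2 + m2)).
    have [L hL] := bounded_sums_ex bs.
    by rewrite -(has_usumM hL (has_usum_dgauss _ _) (has_usum_dgauss _ _)).
  have := has_usum_fst hl hm => /(has_usum_unique (has_usum_finType _)) <-.
  rewrite /dwigner mulrA.
  have -> : (d%:R ^+ 2 * (1 / d%:R ^+ 2)%:C : R[i]) = 1.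
    have -> : (d%:R ^+ 2 : R[i]) = (d%:R ^+ 2)%:C by rewrite rmorphXn/= rmorph_nat.
    by rewrite -rmorphM/= mulrCA divff ?mulr1// gt_eqF// exprn_gt0.
  rewrite mul1r pair_big/=; apply: eq_bigr => m _.
  rewrite /phase rmorphM/= mulrA; congr (_ * _ * _).
  rewrite conj_Creal// realE.
  by have := le_total 0 (dgauss j sigma (n1 - (m.1%:Z - j%:Z)) (n2 - (m.2%:Z - j%:Z)));
    rewrite -!lecR.
apply: eq_has_usum (has_usum_reindex h'K hK hl) => q.
by rewrite -[LHS]/(W (h' q).1 (h' q).2) -TW h'K.
Qed.


(** [weight] for the inverse of [sigma], the momentum factor of the Wigner function. *)
Definition dual_weight (x y : R) : R := expR (- (s ^+ 2 * qform c (- b) a x y / D)).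

Lemma bounded_sums_weight (n n' : int) :
  bounded_sums (fun p : int * int => weight (half_shift n p.1) (half_shift n' p.2)).
Proof.
have k0 : 0 < s ^+ 2 * (d%:R / 2) ^+ 2 by rewrite mulr_gt0// exprn_gt0// divr_gt0.
apply: bounded_sums_le (bounded_sums_qform (2 * n%:~R / d%:R) (2 * n'%:~R / d%:R) a0 D0 k0).
  by move=> p; exact: expR_ge0.
move=> p; rewrite le_eqVlt; apply/orP; left; apply/eqP; rewrite /weight /half_shift.
congr expR; rewrite /qform; by move: dN0; generalize (d%:R : R) => e e0; field.
Qed.

Lemma bounded_sums_dual_weight (k k' : int) :
  bounded_sums (fun p : int * int => dual_weight (half_shift k p.1) (half_shift k' p.2)).
Proof.
have D'0 : 0 < c * a - (- b) ^+ 2 by rewrite sqrrN mulrC.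
have k0 : 0 < s ^+ 2 * (d%:R / 2) ^+ 2 / D.
  by rewrite divr_gt0// mulr_gt0// exprn_gt0// divr_gt0.
apply: bounded_sums_le (bounded_sums_qform (2 * k%:~R / d%:R) (2 * k'%:~R / d%:R) c0 D'0 k0).
  by move=> p; exact: expR_ge0.
move=> p; rewrite le_eqVlt; apply/orP; left; apply/eqP; rewrite /dual_weight /half_shift.
congr expR; rewrite /qform; move: dN0 (lt0r_neq0 D0).
by generalize (d%:R : R) D => e f e0 f0; field; rewrite ?e0 ?f0 ?dN0.
Qed.

Definition phase_sign (g q : int * int) : R[i] := (-1) ^ (g.1 * q.1 + g.2 * q.2).

Lemma phase_signE g q : phase_sign g q = expi (pi * (g.1 * q.1 + g.2 * q.2)%:~R).
Proof. by rewrite expi_pi. Qed.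

(* Since d is odd, exp(i pi d z) = (-1)^z. *)
Lemma poisson_half : exists kappa : R[i], forall k1 k2 : int, forall g : int * int, exists S,
  has_usum (fun M : int * int => (weight (half_shift M.1 g.1) (half_shift M.2 g.2))%:C *
     expi (- (4 * pi / d%:R) * (k1 * M.1 + k2 * M.2)%:~R)) (kappa * S) /\
  has_usum (fun q : int * int => phase_sign g q * (dual_weight (half_shift k1 q.1) (half_shift k2 q.2))%:C) S.
Proof.
have sa0 : 0 < s ^+ 2 * a by rewrite mulr_gt0.
have DE : (s ^+ 2 * a) * (s ^+ 2 * c) - (s ^+ 2 * b) ^+ 2 = (s ^+ 2) ^+ 2 * D by ring.
have sD0 : 0 < (s ^+ 2 * a) * (s ^+ 2 * c) - (s ^+ 2 * b) ^+ 2.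
  by rewrite DE mulr_gt0// exprn_gt0.
have [kappa hk] := poisson_gauss2 sa0 sD0.
exists kappa => l1 l2 g.
(* With these shifts [M + t] is a half shift of [M] by [g], and [q + y] is [2 / d] times a half
   shift of [l] by [q]. *)
have [S [h1 h2]] := hk (g.1%:~R * (d%:R / 2)) (g.2%:~R * (d%:R / 2))
  (2 * l1%:~R / d%:R) (2 * l2%:~R / d%:R).
exists S; split.
  apply: eq_has_usum h1 => M; congr ((expR _)%:C * expi _).
    by rewrite /half_shift /qform; ring.
  rewrite intrD !intrM; move: dN0; generalize (d%:R : R) => e e0; field.
  by rewrite ?e0 ?dN0.
apply: eq_has_usum h2 => q; rewrite mulrC; congr (_ * (expR _)%:C).
  (* Whole turns come from [l.g] and from the even part [2 j] of [d]; what is left is [pi] times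
     [g.q]. *)
  have -> : 2 * pi * ((q.1%:~R + 2 * l1%:~R / d%:R) * (g.1%:~R * (d%:R / 2)) +
       (q.2%:~R + 2 * l2%:~R / d%:R) * (g.2%:~R * (d%:R / 2))) =
    pi * (g.1 * q.1 + g.2 * q.2)%:~R +
    2 * pi * (l1 * g.1 + l2 * g.2 + j%:Z * (g.1 * q.1 + g.2 * q.2))%:~R :> R.
    have dj : d%:R = 2 * j%:R + 1 :> R by rewrite /period natrD natrM.
    rewrite !(rmorphD, rmorphM)/= -!pmulrn; move: dN0 dj.
    generalize (d%:R : R) => e e0 ej.
    have -> : (j%:R : R) = (e - 1) / 2 by rewrite ej; field.
    field; have -> : e - 1 + (e - 1) + 2 = 2 * e by ring.
    by rewrite mulf_neq0.
  by rewrite expiD expi_2piM mulr1 phase_signE.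
congr (- _); rewrite DE /half_shift.
(* The scale is such that [pi / s ^ 2 = d / 2], the factor that turns [q + y] into a half shift. *)
have -> : pi = s ^+ 2 * d%:R / 2 :> R.
  by rewrite s2 divfK// mulrAC divff ?mul1r.
move: (lt0r_neq0 D0) (lt0r_neq0 s20); rewrite /qform.
by generalize D (s ^+ 2) => f z f0 z0; field; rewrite ?f0 ?z0 ?dN0 ?dN1.
Qed.

End Discrete.

Theorem mainTheorem3 (R : realType) (j : nat) (sigma : 'M[R]_2)
    (sigma_sym : sigma^T = sigma) (sigma_pos : posdef sigma) :
  exists C : R[i], forall n1 n2 k1 k2 : int,
    let term (a1 a2 b1 b2 : int) : R[i] :=
      (-1) ^ (a1 * b1 + a2 * b2) *
      wigner (fun q1 q2 => (gauss sigma q1 q2)%:C)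
        (halfpt R j n1 a1) (halfpt R j n2 a2)
        (halfpt R j k1 b1) (halfpt R j k2 b2) in
    [/\ forall a1 a2 : int, cvg_sumZ2 (term a1 a2),
        cvg_sumZ2 (fun a1 a2 => sumZ2 (term a1 a2))
      & dwigner j (fun m1 m2 => (dgauss j sigma m1 m2)%:C) n1 n2 k1 k2
        = C * sumZ2 (fun a1 a2 => sumZ2 (term a1 a2))].
Proof.
have [w0 w00 hw] := wigner_gauss sigma_sym sigma_pos.
have [kappa hk] := poisson_half j sigma_sym sigma_pos.
(* [kappa] comes from Poisson summation, [d ^ 2] from the normalisation of [dwigner], [w0] from the
   continuous Wigner function. *)
exists (kappa / ((period j)%:R ^+ 2 * w0%:C)) => n1 n2 k1 k2 term.
have [S hS] := choice (hk k1 k2).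
pose Eg (g : int * int) := weight j sigma (half_shift R j n1 g.1) (half_shift R j n2 g.2).
have termE g q : term g.1 g.2 q.1 q.2 = (w0 * Eg g)%:C *
    (phase_sign R g q * (dual_weight j sigma (half_shift R j k1 q.1) (half_shift R j k2 q.2))%:C).
  rewrite /term hw [RHS]mulrCA -[X in _ = _ * X]rmorphM; congr (_ * _%:C).
  rewrite -[RHS]mulrA; congr (_ * (expR _ * expR _)).
    by rewrite /halfpt /half_shift /qform; ring.
  by rewrite /halfpt /half_shift /qform; ring.
have hterm g : has_usum (fun q : int * int => term g.1 g.2 q.1 q.2) ((w0 * Eg g)%:C * S g).
  by apply: eq_has_usum (has_usumZ _ (hS g).2) => q; rewrite termE.
(* Convergence of the outer sum: the joint family in [(g, q)] is dominated by a multiple of [weight]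
   times [dual_weight], and Fubini descends to [g]. *)
have [V hV] : exists V, has_usum (fun g => (w0 * Eg g)%:C * S g) V.
  pose F (p : (int * int) * (int * int)) := term p.1.1 p.1.2 p.2.1 p.2.2.
  have [V hV] : exists V, has_usum F V.
    have bF := bounded_sumsZ (normr_ge0 w0) (bounded_sumsM
      (bounded_sums_weight j sigma_sym sigma_pos n1 n2)
      (bounded_sums_dual_weight j sigma_sym sigma_pos k1 k2)).
    apply: (dominated_usum _ bF) => p.
    rewrite /F termE normrM normC_real phase_signE [X in _ * `|X|]mulrC norm_real_expi ?expR_ge0//.
    by rewrite -rmorphM lecR normrM (ger0_norm (expR_ge0 _)) mulrA.
  by exists V; apply: has_usum_fst hV _ => g; exact: hterm.
have hV' : has_usum (fun g : int * int => sumZ2 (term g.1 g.2)) V.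
  by apply: eq_has_usum hV => g; rewrite (has_usum_sumZ2 (hterm g)).2.
split.
- by move=> a1 a2; exact: (has_usum_sumZ2 (hterm (a1, a2))).1.
- exact: (has_usum_sumZ2 hV').1.
rewrite (has_usum_sumZ2 hV').2.
have d0 : ((period j)%:R ^+ 2 : R[i]) != 0.
  by rewrite expf_neq0// pnatr_eq0 -lt0n period_gt0.
have w0C : (w0%:C : R[i]) != 0 by rewrite (inj_eq (@complexI _)).
apply: (mulfI d0).
have -> : (period j)%:R ^+ 2 * (kappa / ((period j)%:R ^+ 2 * w0%:C) * V) = kappa / w0%:C * V.
  by rewrite mulrA; congr (_ * V); rewrite mulrCA invfM mulVKf.
(* At fixed [gamma], the sum over [M] is the inner sum of the theorem up to a factor independent of
   [gamma]. *)
have hrow g : has_usum (fun M => doubled_term j sigma n1 n2 k1 k2 (g, M))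
    (kappa / w0%:C * ((w0 * Eg g)%:C * S g)).
  have -> : kappa / w0%:C * ((w0 * Eg g)%:C * S g) = (Eg g)%:C * (kappa * S g).
    by rewrite rmorphM/=; field.
  apply: eq_has_usum (has_usumZ _ (hS g).1) => M.
  by rewrite /doubled_term/= rmorphM/= mulrA.
apply: has_usum_unique (has_usum_fst (has_usum_dwigner j sigma_sym sigma_pos n1 n2 k1 k2) hrow) _.
exact: has_usumZ.
Qed.
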